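(* Let $N\in\mathbb N$, let $d\in\mathbb Z$, and let $C$ be a chain complex of finite rank free $\mathbb Z^N$-persistence modules such that the modules $H_d(C),\dotsc,H_{d+N}(C)$ eventually vanish. If $G$ is a minimal free resolution of $H^{d+N}(C^\dagger)$, then $G[N]^\dagger$, viewed as a chain complex, is a minimal free resolution of $H_d(C)$.
   Context: Fix a field $\mathbb F$ and $N\in\mathbb N$; $\mathbb Z^N$ carries the product partial order. A $\mathbb Z^N$-persistence module is a functor $M$ from the poset $\mathbb Z^N$ to finite-dimensional $\mathbb F$-vector spaces, with components $M_z$; morphisms are natural transformations, and $\operatorname{Hom}(L,M)$ is the vector space of morphisms. Kernels, cokernels and (co)homology are computed componentwise. $M$ eventually vanishes if its support $\{z\in\mathbb Z^N: M_z\ne 0\}$ is bounded above. The shift $M\langle z\rangle$ has components $M\langle z\rangle_w=M_{z+w}$. For $z\in\mathbb Z^N$, $F(z)$ is the persistence module with $F(z)_v=\mathbb F$ if $z\le v$ and $0$ otherwise, with identities between nonzero components. A persistence module is free if it is isomorphic to a direct sum of modules $F(z)$, $z\in\mathbb Z^N$; it has finite rank if the sum can be taken finite. Global dual: with $\mathbf 1=(1,\dotsc,1)$, $(M^\dagger)_z=\operatorname{Hom}(M,F(\mathbf 1)\langle z\rangle)=\operatorname{Hom}(M,F(\mathbf 1-z))$ with induced structure maps; in particular $F(z)^\dagger\cong F(\mathbf 1-z)$. It is contravariant and applied degreewise to complexes: $(C^\dagger)^d=(C_d)^\dagger$. A free resolution of $M$ is a chain complex $G$ of free modules concentrated in nonnegative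 degrees together with a morphism $\varepsilon\colon G_0\to M$ such that $\dotsb\to G_1\to G_0\xrightarrow{\varepsilon} M\to 0$ is exact. A homological ball is a chain complex $\dotsb\to0\to F(z)\xrightarrow{\mathrm{id}}F(z)\to0\to\dotsb$ concentrated in two consecutive degrees. A chain complex of finite rank free modules is minimal if it has no homological ball as a direct summand; a minimal free resolution is a free resolution (by finite rank free modules) that is minimal as a chain complex. $G[N]$ is the shifted complex $G[N]_d=G_{d+N}$; $G[N]^\dagger$ is the cochain complex with $(G[N]^\dagger)^d=(G_{d+N})^\dagger$, viewed as a chain complex via $D_d=D^{-d}$, so that its component in homological degree $d$ is $(G_{N-d})^\dagger$. *)

(* Defs.v *)
From HB Require Import structures.
From mathcomp Require Import all_boot all_order all_algebra.
From mathcomp Require Import generic_quotient ring_quotient.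
From mathcomp Require Import boolp.

Set Implicit Arguments.
Unset Strict Implicit.
Unset Printing Implicit Defensive.

Import Order.TTheory GRing.Theory Num.Theory.
Local Open Scope ring_scope.
Local Open Scope quotient_scope.

Lemma linear_ext (F : fieldType) (U V : lmodType F) (f g : {linear U -> V}) :
  f =1 g -> f = g.
Proof.
case: f g => [f [[cf1] [cf2]]] [g [[cg1] [cg2]]] /= /funext fg; subst g.
by rewrite (Prop_irrelevance cf1 cg1) (Prop_irrelevance cf2 cg2).
Qed.

Section FiniteDimension.
Context (F : fieldType).
Implicit Types U V : lmodType F.

Definition fin_dim V : Prop :=
  exists (n : nat) (e : 'I_n -> V),
    forall x, exists a : 'I_n -> F, x = \sum_i a i *: e i.

Lemma fin_dim_surj U V (f : {linear U -> V}) :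
  (forall y, exists x, f x = y) -> fin_dim U -> fin_dim V.
Proof.
move=> fs [n [e he]]; exists n, (f \o e) => y; have [x <-] := fs y.
have [a ->] := he x; exists a; rewrite linear_sum.
by apply: eq_bigr => i _; rewrite linearZ.
Qed.

Lemma fin_dim_prod U V : fin_dim U -> fin_dim V -> fin_dim (U * V)%type.
Proof.
move=> [m [u hu]] [n [v hv]].
exists (m + n)%N, (fun i => match split i with inl j => (u j, 0) | inr j => (0, v j) end).
move=> [x y]; have [a ->] := hu x; have [b ->] := hv y.
exists (fun i => match split i with inl j => a j | inr j => b j end).
rewrite big_split_ord /=.
have El j : split (lshift n j) = inl j := unsplitK (inl j).
have Er j : split (rshift m j) = inr j := unsplitK (inr j).
rewrite (eq_bigr (fun j => a j *: (u j, 0))); last by move=> j _; rewrite El.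
rewrite [X in _ + X](eq_bigr (fun j => b j *: (0, v j))); last by move=> j _; rewrite Er.
have pairE (p q : (U * V)%type) : p.1 = q.1 -> p.2 = q.2 -> p = q.
  by case: p q => [? ?] [? ?] /= -> ->.
apply: pairE; rewrite linearD !linear_sum /=.
  by rewrite [X in _ + X]big1 ?addr0 // => i _; rewrite scaler0.
by rewrite [X in X + _]big1 ?add0r // => i _; rewrite scaler0.
Qed.

Lemma fin_dim_inj U V (f : {linear U -> V}) :
  injective f -> fin_dim V -> fin_dim U.
Proof.
move=> fi [n [e he]].
suff key (P : U -> Prop) (P_lin : forall a x y, P x -> P y -> P (a *: x + y)) :
    (forall x, P x -> exists a : 'I_n -> F, f x = \sum_i a i *: e i) ->
    exists (m : nat) (u : 'I_m -> U),
      forall x, P x -> exists b : 'I_m -> F, x = \sum_i b i *: u i.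
  have [//|m [u hu]] := key (fun=> True) (fun _ _ _ _ _ => I).
  by exists m, u => x; exact: hu.
elim: n e {he} P P_lin => [|n IHn] e P P_lin hP.
  exists 0, (fun=> 0) => x /hP[a]; rewrite big_ord0 => fx; exists (fun=> 0).
  by rewrite big_ord0; apply: fi; rewrite fx linear0.
pose e' i := e (widen_ord (leqnSn n) i).
have [[x0 [a [Px0 fx0 a0]]]|none] := pselect (exists x0 a, [/\ P x0,
    f x0 = \sum_i a i *: e i & a ord_max != 0]); last first.
  apply: (IHn e' P) => // x Px; have [a fx] := hP x Px.
  exists (fun i => a (widen_ord (leqnSn n) i)); rewrite fx big_ord_recr /=.
  have [->|a0] := eqVneq (a ord_max) 0; first by rewrite scale0r addr0.
  by case: none; exists x, a.
pose P' x := P x /\ exists b : 'I_n -> F, f x = \sum_i b i *: e' i.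
have P'_lin c x y : P' x -> P' y -> P' (c *: x + y).
  move=> [Px [bx fx]] [Py [b_y fy]]; split; first exact: P_lin.
  exists (fun i => c * bx i + b_y i); rewrite linearP fx fy scaler_sumr -big_split.
  by apply: eq_bigr => i _; rewrite scalerDl scalerA.
have [m [u hu]] := IHn e' P' P'_lin (fun x => @proj2 _ _).
exists m.+1, (fun i => oapp u x0 (unlift ord_max i)) => x Px.
have [c fx] := hP x Px; pose t := c ord_max / a ord_max.
have [|b hb] := hu (- t *: x0 + x).
  split; first exact: P_lin.
  exists (fun i => c (widen_ord (leqnSn n) i) - t * a (widen_ord (leqnSn n) i)).
  rewrite linearP fx fx0 !big_ord_recr /= scalerDr addrACA scalerA mulNr divfK //.
  rewrite [- _ *: _ + _ *: _]addrC -scalerDl subrr scale0r addr0.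
  rewrite scaler_sumr -big_split.
  by apply: eq_bigr => i _; rewrite /= scalerA -scalerDl mulNr addrC.
exists (fun i => oapp b t (unlift ord_max i)).
rewrite big_ord_recr /= unlift_none /=.
rewrite (eq_bigr (fun i => b i *: u i)); last first.
  move=> i _; suff -> : widen_ord (leqnSn m) i = lift ord_max i by rewrite liftK.
  by apply: val_inj; rewrite /= /bump leqNgt ltn_ord.
by rewrite -hb scaleNr addrAC addNr add0r.
Qed.

End FiniteDimension.

Section Quotients.
Context (F : fieldType) (V : lmodType F) (S : submodClosed V).

(* submodClosed does not inherit from the zmodClosed expected by Quotient.quot *)
Definition submod_pred : {pred V} := [pred x | x \in S].

Lemma submod_zmod : zmod_closed submod_pred.
Proof.
split=> [|x y]; rewrite !inE ?rpred0 // => xS yS.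
by rewrite -scaleN1r addrC rpredD ?rpredZ.
Qed.
HB.instance Definition _ := GRing.isZmodClosed.Build V submod_pred submod_zmod.

Definition lquot := Quotient.quot submod_pred.
HB.instance Definition _ := GRing.Zmodule.on lquot.

Definition lpi (x : V) : lquot := \pi_(Quotient.quot submod_pred) x.

Lemma lpiE x y : lpi x = lpi y <-> x - y \in S.
Proof.
have -> : (x - y \in S) = (x - y \in submod_pred) by rewrite inE.
by rewrite Quotient.idealrBE; split=> [/eqP|/eqP].
Qed.

Lemma lpi_repr (q : lquot) : lpi (repr q) = q.
Proof. exact: reprK. Qed.

Lemma lpiD x y : lpi (x + y) = lpi x + lpi y.
Proof. exact: Quotient.pi_add. Qed.

Definition lquot_scale (a : F) (q : lquot) : lquot := lpi (a *: repr q).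

Lemma lpiZ a x : lpi (a *: x) = lquot_scale a (lpi x).
Proof. by apply/lpiE; rewrite -scalerBr rpredZ //; apply/lpiE; rewrite lpi_repr. Qed.

Lemma lquot_scaleA a b q :
  lquot_scale a (lquot_scale b q) = lquot_scale (a * b) q.
Proof. by rewrite -[q]lpi_repr -!lpiZ scalerA. Qed.

Lemma lquot_scale1 : left_id 1 lquot_scale.
Proof. by move=> q; rewrite -[q]lpi_repr -lpiZ scale1r. Qed.

Lemma lquot_scaleDr : right_distributive lquot_scale +%R.
Proof.
by move=> a p q; rewrite -[p]lpi_repr -[q]lpi_repr -!(lpiD, lpiZ) scalerDr.
Qed.

Lemma lquot_scaleDl q : {morph lquot_scale^~ q : a b / a + b}.
Proof. by move=> a b; rewrite -[q]lpi_repr -!(lpiZ, lpiD) scalerDl. Qed.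

HB.instance Definition _ := GRing.Zmodule_isLmodule.Build F lquot
  lquot_scaleA lquot_scale1 lquot_scaleDr lquot_scaleDl.

Lemma lpi_linear : linear lpi.
Proof. by move=> a x y; rewrite lpiD lpiZ. Qed.
HB.instance Definition _ := GRing.isLinear.Build F V lquot _ lpi lpi_linear.

End Quotients.

Section Subquotient.
Context (F : fieldType) (U V W : lmodType F).
Variables (f : {linear U -> V}) (g : {linear V -> W}).

Definition kernel_pred : {pred V} := [pred x | g x == 0].

Lemma kernel_submod : submod_closed kernel_pred.
Proof.
split=> [|a x y]; rewrite !inE ?linear0 //.
by move=> /eqP gx /eqP gy; rewrite linearP gx gy scaler0 addr0.
Qed.
HB.instance Definition _ :=
  GRing.isSubmodClosed.Build F V kernel_pred kernel_submod.

Record kernel := Kernel { kernel_val :> V; _ : kernel_val \in kernel_pred }.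
HB.instance Definition _ := [isSub for kernel_val].
HB.instance Definition _ := [Choice of kernel by <:].
HB.instance Definition _ := [SubChoice_isSubLmodule of kernel by <:].

Definition image_pred : {pred kernel} :=
  [pred x : kernel | `[< exists y, f y = val x >]].

Lemma image_submod : submod_closed image_pred.
Proof.
split=> [|a x y]; rewrite !inE.
  by apply/asboolP; exists 0; rewrite !linear0.
move=> /asboolP[x' fx] /asboolP[y' fy]; apply/asboolP.
by exists (a *: x' + y'); rewrite !linearP fx fy.
Qed.
HB.instance Definition _ :=
  GRing.isSubmodClosed.Build F kernel image_pred image_submod.

(* ker g / (im f :&: ker g), so that no proof of g \o f = 0 is needed *)
Definition subquotient : lmodType F := lquot image_pred.

End Subquotient.

Section Modules.
Context (F : fieldType) (N : nat).

Definition grade : zmodType := {ffun 'I_N -> int}.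

Definition gle (z w : grade) : bool := [forall i, (z i <= w i)%R].

Lemma gleP (z w : grade) : reflect (forall i, (z i <= w i)%R) (gle z w).
Proof. exact: forallP. Qed.

Lemma gle_refl z : gle z z.
Proof. exact/gleP. Qed.

Lemma gle_trans w z v : gle z w -> gle w v -> gle z v.
Proof.
by move=> /gleP zw /gleP wv; apply/gleP => i; exact: le_trans (wv i).
Qed.

Lemma gleD2r u z w : gle z w -> gle (z + u) (w + u).
Proof. by move=> /gleP h; apply/gleP => i; rewrite !ffunE lerD2r. Qed.

(* Functors from the poset Z^N to F-vector spaces. Finite-dimensionality of the *)
(* components is the separate predicate [pfd]: it cannot be bundled, since the  *)
(* global dual of a [pfd] module need not be [pfd]. Finite rank free modules    *)
(* are [pfd], and so are subquotients and direct summands of [pfd] modules, as  *)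
(* shown at the end of the file.                                                *)
Record pmod := PMod {
  pobj :> grade -> lmodType F;
  pmap : forall z w, gle z w -> {linear pobj z -> pobj w};
  pmap_id : forall z (h : gle z z) x, pmap h x = x;
  pmap_comp : forall z w v (h1 : gle z w) (h2 : gle w v) (h3 : gle z v) x,
    pmap h2 (pmap h1 x) = pmap h3 x }.

Arguments pmap : clear implicits.
Arguments pmap p {z w} h : rename.

Record phom (L M : pmod) := PHom {
  happ :> forall z, {linear L z -> M z};
  happ_nat : forall z w (h : gle z w) x,
    happ w (pmap _ h x) = pmap _ h (happ z x) }.

Lemma phomP (L M : pmod) (f g : phom L M) :
  (forall z x, f z x = g z x) -> f = g.
Proof.
case: f g => [f fn] [g gn] /= fg.
have e : f = g by apply: functional_extensionality_dep => z; apply: linear_ext => x; exact: fg.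
by subst g; rewrite (Prop_irrelevance fn gn).
Qed.

Section HomSpace.
Context (L M : pmod).
Implicit Types f g : phom L M.

HB.instance Definition _ := gen_eqMixin (phom L M).
HB.instance Definition _ := gen_choiceMixin (phom L M).

Definition phom0 : phom L M.
Proof.
refine (@PHom L M (fun z => (\0 : L z -> M z)) _).
abstract by move=> z w h x /=; rewrite linear0.
Defined.

Definition phom_opp f : phom L M.
Proof.
refine (@PHom L M (fun z => (\- f z : L z -> M z)) _).
abstract by move=> z w h x /=; rewrite happ_nat linearN.
Defined.

Definition phom_add f g : phom L M.
Proof.
refine (@PHom L M (fun z => (f z \+ g z : L z -> M z)) _).
abstract by move=> z w h x /=; rewrite !happ_nat linearD.
Defined.

Definition phom_scale (a : F) f : phom L M.
Proof.
refine (@PHom L M (fun z => (a \*: f z : L z -> M z)) _).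
abstract by move=> z w h x /=; rewrite happ_nat linearZ.
Defined.

Lemma phom_addA : associative phom_add.
Proof. by move=> f g h; apply: phomP => z x /=; rewrite addrA. Qed.
Lemma phom_addC : commutative phom_add.
Proof. by move=> f g; apply: phomP => z x /=; rewrite addrC. Qed.
Lemma phom_add0 : left_id phom0 phom_add.
Proof. by move=> f; apply: phomP => z x /=; rewrite add0r. Qed.
Lemma phom_addN : left_inverse phom0 phom_opp phom_add.
Proof. by move=> f; apply: phomP => z x /=; rewrite addNr. Qed.
HB.instance Definition _ := GRing.isZmodule.Build (phom L M)
  phom_addA phom_addC phom_add0 phom_addN.

Lemma phom_scaleA a b f : phom_scale a (phom_scale b f) = phom_scale (a * b) f.
Proof. by apply: phomP => z x /=; rewrite scalerA. Qed.
Lemma phom_scale1 : left_id 1 phom_scale.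
Proof. by move=> f; apply: phomP => z x /=; rewrite scale1r. Qed.
Lemma phom_scaleDr : right_distributive phom_scale +%R.
Proof. by move=> a f g; apply: phomP => z x /=; rewrite scalerDr. Qed.
Lemma phom_scaleDl f : {morph phom_scale^~ f : a b / a + b}.
Proof. by move=> a b; apply: phomP => z x /=; rewrite scalerDl. Qed.
HB.instance Definition _ := GRing.Zmodule_isLmodule.Build F (phom L M)
  phom_scaleA phom_scale1 phom_scaleDr phom_scaleDl.

End HomSpace.

Definition pid M : phom M M.
Proof. exact: (@PHom M M (fun z => idfun)). Defined.

Definition pcomp (K L M : pmod) (g : phom L M) (f : phom K L) : phom K M.
Proof.
refine (@PHom K M (fun z => (g z \o f z : K z -> M z)) _).
abstract by move=> z w h x /=; rewrite !happ_nat.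
Defined.

Definition piso (L M : pmod) : Prop :=
  exists (f : phom L M) (g : phom M L), pcomp g f = pid L /\ pcomp f g = pid M.

Definition pfd (M : pmod) : Prop := forall z, fin_dim (M z).

Definition eventually_vanishes (M : pmod) : Prop :=
  exists u : grade, forall z, (exists x : M z, x != 0) -> gle z u.

Definition is_zero (M : pmod) : Prop := forall z (x : M z), x = 0.

Definition pzero : pmod.
Proof. exact: (@PMod (fun _ => 'rV[F]_0) (fun z w h => idfun)). Defined.

Section DirectSum.
Context (L M : pmod).

Definition psum_map z w (h : gle z w) (x : L z * M z) : L w * M w :=
  (pmap _ h x.1, pmap _ h x.2).

Lemma psum_map_linear z w (h : gle z w) : linear (psum_map h).
Proof. by move=> a x y; rewrite /psum_map !linearP. Qed.
HB.instance Definition _ z w h :=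
  GRing.isLinear.Build F _ _ _ (@psum_map z w h) (@psum_map_linear z w h).

Definition psum : pmod.
Proof.
refine (@PMod (fun z => (L z * M z)%type) psum_map _ _).
- abstract by move=> z h [x y]; rewrite /= /psum_map !pmap_id.
- abstract by move=> z w v h1 h2 h3 [x y]; rewrite /= /psum_map !(pmap_comp h1 h2 h3).
Defined.

End DirectSum.

Definition psum_hom_at (K L K' L' : pmod) (f : phom K K') (g : phom L L') z
    (x : psum K L z) : psum K' L' z := (f z x.1, g z x.2).

Lemma psum_hom_linear K L K' L' (f : phom K K') (g : phom L L') z :
  linear (psum_hom_at f g (z := z)).
Proof. by move=> a x y; rewrite /psum_hom_at !linearP. Qed.
HB.instance Definition _ K L K' L' f g z :=
  GRing.isLinear.Build F _ _ _ _ (@psum_hom_linear K L K' L' f g z).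

Definition psum_hom K L K' L' (f : phom K K') (g : phom L L') :
  phom (psum K L) (psum K' L').
Proof.
refine (@PHom (psum K L) (psum K' L') (psum_hom_at f g) _).
abstract by move=> z w h [x y]; rewrite /= /psum_hom_at /= !happ_nat.
Defined.

(* F(z): 'rV[F]_b is a copy of F if b = true and is 0 if b = false, and        *)
(* [pid_mx 1] is the identity between two copies of F                          *)
Definition pF (z : grade) : pmod.
Proof.
refine (@PMod (fun v => 'rV[F]_(gle z v))
  (fun v w _ => mulmxr (pid_mx 1 : 'M[F]_(gle z v, gle z w))) _ _).
- abstract by move=> v h x /=; case: (gle z v) x => x;
    rewrite ?pid_mx_1 ?mulmx1 //; apply/rowP; case.
- abstract by move=> u v w h1 h2 h3 x /=; rewrite -mulmxA mul_pid_mx;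
    case zu: (gle z u) x => x; rewrite ?(gle_trans zu h1) ?(gle_trans zu h3) //;
    rewrite [x]thinmx0 !mul0mx.
Defined.

Definition pfree (s : seq grade) : pmod := foldr (fun z => psum (pF z)) pzero s.

Definition finite_rank_free (M : pmod) : Prop :=
  exists s : seq grade, piso M (pfree s).

Definition pshift (M : pmod) (z : grade) : pmod.
Proof.
refine (@PMod (fun w => M (w + z)) (fun w v h => pmap _ (gleD2r z h)) _ _).
- abstract by move=> w h x; exact: pmap_id.
- abstract by move=> w v u h1 h2 h3 x; exact: pmap_comp.
Defined.

Lemma gleD2l u z w : gle z w -> gle (u + z) (u + w).
Proof. by rewrite ![u + _]addrC; exact: gleD2r. Qed.

Definition pshift_map (M : pmod) z w (h : gle z w) : phom (pshift M z) (pshift M w).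
Proof.
refine (@PHom (pshift M z) (pshift M w) (fun v => pmap _ (gleD2l v h)) _).
abstract by move=> u v k x /=;
  rewrite !(pmap_comp _ _ (gle_trans (gleD2r z k) (gleD2l v h))).
Defined.

Definition grade1 : grade := [ffun=> 1].

Section Dual.

Definition gdual_obj (M : pmod) (z : grade) : lmodType F :=
  phom M (pshift (pF grade1) z).

Definition gdual_smap M z w (h : gle z w) (f : gdual_obj M z) : gdual_obj M w :=
  pcomp (pshift_map (pF grade1) h) f.

Lemma gdual_smap_linear M z w (h : gle z w) : linear (@gdual_smap M z w h).
Proof. by move=> a f g; apply: phomP => v x; rewrite /= mulmxDl scalemxAl. Qed.
HB.instance Definition _ M z w h :=
  GRing.isLinear.Build F _ _ _ (@gdual_smap M z w h) (@gdual_smap_linear M z w h).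

Definition gdual (M : pmod) : pmod.
Proof.
refine (@PMod (gdual_obj M) (@gdual_smap M) _ _).
- abstract by move=> z h f; apply: phomP => v x; exact: (@pmap_id (pF grade1) _ (gleD2l v h)).
- abstract by move=> z w v h1 h2 h3 f; apply: phomP => u x; exact: (@pmap_comp (pF grade1) _ _ _ (gleD2l u h1) (gleD2l u h2) (gleD2l u h3)).
Defined.

Context (L M : pmod) (f : phom L M).

Definition gdual_map_at z (g : gdual M z) : gdual L z := pcomp g f.

Lemma gdual_map_linear z : linear (@gdual_map_at z).
Proof. by move=> a g h; apply: phomP. Qed.
HB.instance Definition _ z :=
  GRing.isLinear.Build F _ _ _ (@gdual_map_at z) (@gdual_map_linear z).

Definition gdual_map : phom (gdual M) (gdual L).
Proof.
refine (@PHom (gdual M) (gdual L) gdual_map_at _).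
abstract by move=> z w h g; apply: phomP.
Defined.

End Dual.

Section Homology.
Context (K L M : pmod) (f : phom K L) (g : phom L M).

Definition hker z := kernel (g z).
Definition hobj z := subquotient (f z) (g z).

Definition hpi z (x : hker z) : hobj z := lpi (@image_pred F _ _ _ (f z) (g z)) x.

Lemma hpi_linear z : linear (@hpi z).
Proof. exact: lpi_linear. Qed.
HB.instance Definition _ z :=
  GRing.isLinear.Build F _ _ _ (@hpi z) (@hpi_linear z).

Lemma hpi_repr z (q : hobj z) : hpi (repr q) = q.
Proof. exact: lpi_repr. Qed.

Lemma hker_mapP z w (h : gle z w) (x : hker z) :
  pmap L h (val x) \in kernel_pred (g w).
Proof.
by case: x => x /=; rewrite !inE happ_nat => /eqP ->; rewrite linear0.
Qed.

Definition hker_map z w (h : gle z w) (x : hker z) : hker w :=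
  Kernel (hker_mapP h x).

Definition hmap z w (h : gle z w) (q : hobj z) : hobj w :=
  hpi (hker_map h (repr q)).

Lemma hmapE z w (h : gle z w) (x : hker z) :
  hmap h (hpi x) = hpi (hker_map h x).
Proof.
apply/lpiE; set y := repr _.
have : y - x \in @image_pred F _ _ _ (f z) (g z) by apply/lpiE; exact: hpi_repr.
rewrite !inE => /asboolP[u fu]; apply/asboolP; exists (pmap K h u).
by rewrite happ_nat fu /= linearB.
Qed.

Lemma hmap_linear z w (h : gle z w) : linear (@hmap z w h).
Proof.
move=> a p q; rewrite -[p]hpi_repr -[q]hpi_repr -linearP !hmapE -linearP.
by congr hpi; apply: val_inj; rewrite /= !linearP.
Qed.
HB.instance Definition _ z w h :=
  GRing.isLinear.Build F _ _ _ (@hmap z w h) (@hmap_linear z w h).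

Definition phomology : pmod.
Proof.
refine (@PMod hobj hmap _ _).
- abstract by move=> z h q; rewrite -[q]hpi_repr /= hmapE; congr hpi;
    apply: val_inj; exact: pmap_id.
- abstract by move=> z w v h1 h2 h3 q; rewrite -[q]hpi_repr /= !hmapE; congr hpi;
    apply: val_inj; exact: pmap_comp.
Defined.

End Homology.

(* The differentials are indexed by all pairs of degrees, and vanish outside   *)
(* consecutive ones, to avoid transports along equalities of degrees.          *)
Record complex := Complex {
  cobj :> int -> pmod;
  cdiff : forall i j, phom (cobj i) (cobj j);
  cdiff_shape : forall i j, i <> j + 1 -> cdiff i j = 0;
  cdiff_comp : forall i j k, pcomp (cdiff j k) (cdiff i j) = 0 }.

Record cocomplex := Cocomplex {
  coobj :> int -> pmod;
  codiff : forall i j, phom (coobj i) (coobj j);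
  codiff_shape : forall i j, j <> i + 1 -> codiff i j = 0;
  codiff_comp : forall i j k, pcomp (codiff j k) (codiff i j) = 0 }.

Definition homology (C : complex) (d : int) : pmod :=
  phomology (cdiff C (d + 1) d) (cdiff C d (d - 1)).

Definition cohomology (D : cocomplex) (d : int) : pmod :=
  phomology (codiff D (d - 1) d) (codiff D d (d + 1)).

Definition cgdual (C : complex) : cocomplex.
Proof.
refine (@Cocomplex (fun d => gdual (C d)) (fun i j => gdual_map (cdiff C j i)) _ _).
- abstract by move=> i j /cdiff_shape ->; apply: phomP => z g; apply: phomP => w x;
    rewrite /= linear0.
- abstract by move=> i j k; apply: phomP => z g; apply: phomP => w x;
    have /(congr1 (fun h : phom _ _ => h w x)) /= -> := cdiff_comp C k j i;
    rewrite linear0.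
Defined.

Definition chain_of_cochain (D : cocomplex) : complex.
Proof.
refine (@Complex (fun d => D (- d)) (fun i j => codiff D (- i) (- j)) _ _).
- abstract by move=> i j ij; apply: codiff_shape => e; apply: ij;
    rewrite -[i]opprK -[j]opprK e opprD addrNK.
- abstract by move=> i j k; exact: codiff_comp.
Defined.

Definition cshift (C : complex) (n : int) : complex.
Proof.
refine (@Complex (fun d => C (d + n)) (fun i j => cdiff C (i + n) (j + n)) _ _).
- abstract by move=> i j ij; apply: cdiff_shape; rewrite addrAC => /addIr.
- abstract by move=> i j k; exact: cdiff_comp.
Defined.

Definition csum (C D : complex) : complex.
Proof.
refine (@Complex (fun d => psum (C d) (D d))
  (fun i j => psum_hom (cdiff C i j) (cdiff D i j)) _ _).
- abstract by move=> i j ij; rewrite !cdiff_shape //; apply: phomP.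
- abstract by move=> i j k; apply: phomP => z [x y];
    have /(congr1 (fun h : phom _ _ => h z x)) /= e := cdiff_comp C i j k;
    have /(congr1 (fun h : phom _ _ => h z y)) /= e' := cdiff_comp D i j k;
    rewrite /= /psum_hom_at /= e e'.
Defined.

Definition pif (b : bool) (M : pmod) : pmod := if b then M else pzero.

Definition pif_id (b c : bool) (M : pmod) : phom (pif b M) (pif c M) :=
  match b, c return phom (pif b M) (pif c M) with
  | true, true => pid M
  | _, _ => 0
  end.

Definition in_ball (k d : int) : bool := (d == k + 1) || (d == k).

(* F(z) --id--> F(z) in degrees k + 1 and k *)
Definition ball (z : grade) (k : int) : complex.
Proof.
refine (@Complex (fun d => pif (in_ball k d) (pF z))
  (fun i j => if (i == k + 1) && (j == k)
              then pif_id (in_ball k i) (in_ball k j) (pF z) else 0) _ _).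
- abstract by move=> i j ij; case: ifP => // /andP[/eqP e1 /eqP e2];
    case: ij; rewrite e1 e2.
- abstract by move=> i j l; apply: phomP => w x; case: (j =P k) => [->|_];
    [rewrite [k == k + 1](_ : _ = false) // eq_sym -subr_eq0 addrAC subrr
    | rewrite andbF /= linear0].
Defined.

Definition ciso (C D : complex) : Prop :=
  exists (f : forall i, phom (C i) (D i)) (g : forall i, phom (D i) (C i)),
    [/\ forall i j, pcomp (f j) (cdiff C i j) = pcomp (cdiff D i j) (f i),
        forall i, pcomp (g i) (f i) = pid (C i)
      & forall i, pcomp (f i) (g i) = pid (D i)].

(* Meant for complexes C of finite rank free modules; the complement C' is    *)
(* then automatically [pfd].                                                   *)
Definition minimal (C : complex) : Prop :=
  ~ exists (z : grade) (k : int) (C' : complex), ciso C (csum (ball z k) C').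

Definition exact_at (K L M : pmod) (f : phom K L) (g : phom L M) : Prop :=
  forall z (x : L z), g z x = 0 <-> exists y, f z y = x.

Definition resolution (G : complex) (M : pmod) (eps : phom (G 0) M) : Prop :=
  [/\ forall d : int, d < 0 -> is_zero (G d),
      forall z (x : M z), exists y, eps z y = x,
      exact_at (cdiff G 1 0) eps
    & forall d : int, 0 < d -> exact_at (cdiff G (d + 1) d) (cdiff G d (d - 1))].

(* Free of finite rank in each degree, as part of the notion of minimality. *)
Definition minimal_free_resolution (G : complex) (M : pmod) : Prop :=
  [/\ forall d, finite_rank_free (G d),
      exists eps : phom (G 0) M, resolution eps
    & minimal G].

Lemma piso_pfd (L M : pmod) : piso L M -> pfd M -> pfd L.
Proof.
move=> [f [g [gf _]]] fM z; apply: (@fin_dim_inj _ _ _ (f z)) (fM z) => x y.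
move=> /(congr1 (g z)).
by have e u := congr1 (fun h : phom _ _ => h z u) gf; move: (e x) (e y) => /= -> ->.
Qed.

Lemma psum_pfd (L M : pmod) : pfd (psum L M) <-> pfd L /\ pfd M.
Proof.
split=> [fLM|[fL fM] z].
  split=> z.
    by apply: (@fin_dim_surj _ (L z * M z)%type _ fst) (fLM z) => y; exists (y, 0).
  by apply: (@fin_dim_surj _ (L z * M z)%type _ snd) (fLM z) => y; exists (0, y).
exact: fin_dim_prod.
Qed.

Lemma pF_pfd (z : grade) : pfd (pF z).
Proof.
move=> v; exists (gle z v), (fun i => delta_mx 0 i) => x.
by exists (x 0); exact: row_sum_delta.
Qed.

Lemma pfree_pfd (s : seq grade) : pfd (pfree s).
Proof.
elim: s => [|z s IHs] v; last first.
  by have [_ h] := psum_pfd (pF z) (pfree s); apply: h; split=> //; exact: pF_pfd.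
by exists 0%N, (fun=> 0) => x; exists (fun=> 0); rewrite big_ord0 [x]thinmx0.
Qed.

Lemma finite_rank_free_pfd (M : pmod) : finite_rank_free M -> pfd M.
Proof. by move=> [s iso]; exact: piso_pfd iso (@pfree_pfd s). Qed.

Lemma phomology_pfd (K L M : pmod) (f : phom K L) (g : phom L M) :
  pfd L -> pfd (phomology f g).
Proof.
move=> fL z; apply: (@fin_dim_surj _ _ _ (@hpi _ _ _ f g z)) => [q|].
  by exists (repr q); exact: hpi_repr.
apply: (@fin_dim_inj _ _ _ val) (fL z); exact: val_inj.
Qed.

End Modules.

(* Main.v *)
Require Import Defs.
From mathcomp Require Import all_boot all_order all_algebra.
From HB Require Import structures.
From mathcomp Require Import boolp.
Import Defs.
Import Order.TTheory GRing.Theory Num.Theory.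
Set Implicit Arguments.
Unset Strict Implicit.
Unset Printing Implicit Defensive.
Local Open Scope ring_scope.

(** Write M^* for the graded vector space dual of M, with components (M^* )_z = (M_(-z))^*.
    Everything follows from one duality: if C is a complex of finite rank free modules whose
    homology modules H_e(C), ..., H_(e+N)(C) eventually vanish, then H^(e+N)(C^dagger) is
    H_e(C)^*. Applied to C at e = d, it says that E = H^(d+N)(C^dagger) is dual to H_d(C); in
    particular E eventually vanishes, since H_d(C) is supported above the finitely many
    generators of C_d. The homology of the resolution G is E in degree 0 and zero elsewhere, so
    all of it eventually vanishes and the duality applies to G at every e: H^(e+N)(G^dagger)
    vanishes for e <> 0 and is dual to E for e = 0. Hence G[N]^dagger is exact outside degree 0,
    and its homology in degree 0 is dual to the dual E of H_d(C), hence isomorphic to H_d(C).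
    A minimal resolution satisfies G_k = 0 for k > N, so G[N]^dagger lives in nonnegative degrees,
    and transposing matrices preserves minimality.

    The duality is proved in coordinates. The colimit of a free module M is a vector space with
    one basis vector for each generator, and M_v is the span of the generators of grade at most v
    ([frame]); morphisms become matrices, and the dual of F(z) being F(1 - z), the dual complex
    has the transposed matrices ([gdual_map_mx]). A set P of grades that contains everything
    between two of its elements gives a piece of the complex: keep the generators with grade
    in P and truncate the matrices. The piece [stair 0 v], of all grades at most v, is C_v; the
    piece [stair N v], of the grades that exceed v in every coordinate, is the vector space dual
    of the complex C^dagger at -v. Passing from [stair m v] to [stair m.+1 v] exchanges the
    condition b_m <= v_m for v_m < b_m, and the two pieces together form [slab m v], which
    puts no condition on b_m. Since only finitely many generators occur in a given degree, the slab
    looks like [stair m w] for w obtained from v by making v_m huge; as w lies outside the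
    supports of the homology, the slab is acyclic in the relevant degrees ([acyclic_slab]), and
    the connecting map identifies the homology of [stair m.+1 v] in degree k + 1 with that of
    [stair m v] in degree k, naturally in v ([stair_restrict]). After N steps H_e(C)_v is identified with the homology of the last piece in degree e + N ([descent]), and
    linear algebra pairs the latter with H^(e+N)(C^dagger) at -v. The same step with
    the conditions b_m = v_m shows by induction that the generators of grade exactly v form a
    piece that is acyclic above degree N; minimality makes its differential zero, so there are
    no generators in these degrees ([minimal_length]). *)

(** * Relations that define morphisms *)

Section Relations.
Context (F : fieldType) (N : nat).
Implicit Types L M X Y : pmod F N.

Lemma pcompE (K L M : pmod F N) (g : phom L M) (f : phom K L) z x :
  pcomp g f z x = g z (f z x).
Proof. by []. Qed.

(** The maps out of homology are induced by choices of representatives; describing their graphs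
    by relations avoids having to choose representatives compatibly. *)
Lemma rel_phom X Y (R : forall z, X z -> Y z -> Prop) :
  (forall z a x x' y y', R z x y -> R z x' y' -> R z (a *: x + x') (a *: y + y')) ->
  (forall z w (h : gle z w) x y, R z x y -> R w (pmap _ h x) (pmap _ h y)) ->
  (forall z x, exists y, R z x y) ->
  (forall z y, R z 0 y -> y = 0) ->
  exists f : phom X Y, forall z x y, R z x y <-> f z x = y.
Proof.
move=> Rlin Rnat Rtot Rfun.
have uniq z x y y' : R z x y -> R z x y' -> y = y'.
  move=> Ry Ry'; apply/eqP; rewrite -subr_eq0; apply/eqP; apply: (Rfun z).
  have := Rlin z (-1) _ _ _ _ Ry' Ry.
  by rewrite !scaleN1r addNr [- _ + _]addrC.
pose f z x := projT1 (cid (Rtot z x)).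
have fR z x : R z x (f z x) by rewrite /f; case: cid.
have flin z : linear (f z).
  by move=> a x y; apply: uniq (fR _ _) _; apply: Rlin.
pose fl z : {linear X z -> Y z} :=
  HB.pack (f z) (GRing.isLinear.Build F _ _ _ (f z) (flin z)).
have fnat z w (h : gle z w) x : fl w (pmap _ h x) = pmap _ h (fl z x).
  by apply: uniq (fR _ _) _; apply: Rnat.
exists (PHom fnat) => z x y /=; split=> [Rxy|<-]; last exact: fR.
exact: uniq (fR _ _) Rxy.
Qed.

Lemma rel_piso X Y (R : forall z, X z -> Y z -> Prop) :
  (forall z a x x' y y', R z x y -> R z x' y' -> R z (a *: x + x') (a *: y + y')) ->
  (forall z w (h : gle z w) x y, R z x y -> R w (pmap _ h x) (pmap _ h y)) ->
  (forall z x, exists y, R z x y) ->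
  (forall z y, exists x, R z x y) ->
  (forall z y, R z 0 y -> y = 0) ->
  (forall z x, R z x 0 -> x = 0) ->
  exists (f : phom X Y) (g : phom Y X), [/\ pcomp g f = pid X, pcomp f g = pid Y
     & forall z x y, R z x y <-> f z x = y].
Proof.
move=> Rlin Rnat Rtot Rtot' Rfun Rfun'.
have [f fR] := rel_phom Rlin Rnat Rtot Rfun.
have [g gR] : exists g : phom Y X, forall z x y, R z y x <-> g z x = y.
  apply: (rel_phom (R := fun z y x => R z x y)) => // [z a x x' y y'|z w h x y].
    exact: Rlin.
  exact: Rnat.
exists f, g; split=> //; apply: phomP => z x /=.
  by apply/gR; apply/fR.
by apply/fR; apply/gR.
Qed.

End Relations.

(** * Coordinates on free modules *)

Section Frames.
Context (F : fieldType) (N : nat).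
Implicit Types L M : pmod F N.

(** Coordinates with respect to a homogeneous basis of a free module: [fco fr z] embeds M_z
    into the colimit of M, the space with one basis vector for each generator, in such a way that
    all structure maps become inclusions. *)
Record frame (M : pmod F N) (n : nat) (deg : 'I_n -> grade N) := Frame {
  fco : forall z, {linear M z -> 'rV[F]_n};
  fco_nat : forall z w (h : gle z w) x, fco w (pmap _ h x) = fco z x;
  fco_inj : forall z, injective (fco z);
  fco_img : forall z (y : 'rV[F]_n),
    (exists x, fco z x = y) <-> forall i, ~~ gle (deg i) z -> y 0 i = 0 }.

Section OneFrame.
Context (M : pmod F N) (n : nat) (deg : 'I_n -> grade N) (fr : frame M deg).

Lemma fco0 z x i : ~~ gle (deg i) z -> fco fr z x 0 i = 0.
Proof. by move: i; apply/fco_img; exists x. Qed.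

Lemma fgenP i : exists x : M (deg i), fco fr (deg i) x = delta_mx 0 i.
Proof.
apply/fco_img => j; apply: contraNeq; rewrite mxE /=.
by have [->|_] := eqVneq j i; rewrite ?gle_refl ?andbF ?eqxx.
Qed.

Definition fgen i : M (deg i) := projT1 (cid (fgenP i)).

Lemma fco_gen i : fco fr (deg i) (fgen i) = delta_mx 0 i.
Proof. by rewrite /fgen; case: cid. Qed.

Lemma frame_decomp z (x : M z) (t : 'I_n -> M z) :
  (forall i, fco fr z (t i) = fco fr z x 0 i *: delta_mx 0 i) -> x = \sum_i t i.
Proof.
move=> ht; apply: (@fco_inj _ _ _ fr); rewrite linear_sum [LHS]row_sum_delta.
by apply: eq_bigr => i _; rewrite ht.
Qed.

Lemma frame_terms z (x : M z) : exists t : 'I_n -> M z,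
  forall i, fco fr z (t i) = fco fr z x 0 i *: delta_mx 0 i.
Proof.
suff ht i : exists y, fco fr z y = fco fr z x 0 i *: delta_mx 0 i.
  by have [t] := choice ht; exists t.
apply/fco_img => j hj; rewrite !mxE /=; have [ji|_] := eqVneq j i; last by rewrite ?andbF mulr0.
by rewrite -ji fco0 ?mul0r.
Qed.

(** A coordinate that does not vanish at [z] belongs to a generator of grade at most [z], so the
    corresponding term comes from that generator through a structure map. *)
Lemma frame_term z (y : M z) (a : F) i :
  fco fr z y = a *: delta_mx 0 i ->
  (a = 0 /\ y = 0) \/ exists h : gle (deg i) z, y = a *: pmap _ h (fgen i).
Proof.
have [-> |a0] := eqVneq a 0.
  by rewrite scale0r => y0; left; split=> //; apply: (@fco_inj _ _ _ fr); rewrite y0 linear0.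
move=> hy; right; have hi : gle (deg i) z.
  apply: contraNT a0 => /(fco0 y); rewrite hy !mxE !eqxx mulr1 => ->; exact: eqxx.
by exists hi; apply: (@fco_inj _ _ _ fr); rewrite linearZ fco_nat fco_gen hy.
Qed.

End OneFrame.

Section MatrixOfMorphism.
Context (L M : pmod F N) (m n : nat) (degL : 'I_m -> grade N) (degM : 'I_n -> grade N).
Context (frL : frame L degL) (frM : frame M degM).

Definition phom_mx (f : phom L M) : 'M[F]_(m, n) :=
  \matrix_(i, j) fco frM _ (f _ (fgen frL i)) 0 j.

Lemma phom_mxE (f : phom L M) z x : fco frM z (f z x) = fco frL z x *m phom_mx f.
Proof.
have [t ht] := frame_terms frL x.
rewrite [in LHS](frame_decomp ht) !linear_sum mulmx_sum_row; apply: eq_bigr => i _.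
have [[-> ->]|[h ->]] := frame_term (ht i); first by rewrite !linear0 scale0r.
rewrite !linearZ happ_nat fco_nat; congr (_ *: _).
by apply/rowP => j; rewrite !mxE.
Qed.

Lemma phom_mx_uniq (f : phom L M) (A : 'M[F]_(m, n)) :
  (forall z x, fco frM z (f z x) = fco frL z x *m A) -> phom_mx f = A.
Proof.
move=> hA; apply/matrixP => i j; rewrite mxE hA fco_gen -rowE.
by rewrite mxE.
Qed.

Lemma phom_mx_neq0 f i j : phom_mx f i j != 0 -> gle (degM j) (degL i).
Proof. by apply: contraNT => h; rewrite mxE fco0. Qed.

(** A morphism sends a generator to a combination of generators of smaller grade, and this is the
    only constraint: a row vector supported below [z] is mapped to one supported below [z]. *)
Lemma phom_of_mx (A : 'M[F]_(m, n)) :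
  (forall i j, A i j != 0 -> gle (degM j) (degL i)) ->
  exists f : phom L M, phom_mx f = A.
Proof.
move=> hA.
have [f fR] : exists f : phom L M,
  forall z x y, fco frM z y = fco frL z x *m A <-> f z x = y.
  apply: (rel_phom (R := fun z x y => fco frM z y = fco frL z x *m A)).
  - by move=> z a x x' y y' h h'; rewrite !linearP h h' mulmxDl scalemxAl.
  - by move=> z w h x y; rewrite !fco_nat.
  - move=> z x; apply/fco_img => j hj; rewrite mxE big1 // => i _.
    have [Aij|/hA hij] := eqVneq (A i j) 0; first by rewrite Aij mulr0.
    rewrite fco0 ?mul0r //; apply: contra hj; exact: gle_trans.
  - move=> z y; rewrite linear0 mul0mx => y0.
    by apply: (@fco_inj _ _ _ frM); rewrite y0 linear0.
exists f; apply: phom_mx_uniq => z x; exact/fR.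
Qed.

Lemma phom_mx_linear : linear phom_mx.
Proof. by move=> a f g; apply/matrixP => i j; rewrite !mxE linearP !mxE. Qed.

Lemma phom_mx0 : phom_mx 0 = 0.
Proof. by apply/matrixP => i j; rewrite !mxE linear0 mxE. Qed.

Lemma phom_mx_inj : injective phom_mx.
Proof.
move=> f g fg; apply: phomP => z x; apply: (@fco_inj _ _ _ frM).
by rewrite !phom_mxE fg.
Qed.

End MatrixOfMorphism.

Lemma phom_mx_comp (K L M : pmod F N) l m n
    (dK : 'I_l -> grade N) (dL : 'I_m -> grade N) (dM : 'I_n -> grade N)
    (frK : frame K dK) (frL : frame L dL) (frM : frame M dM)
    (g : phom L M) (f : phom K L) :
  phom_mx frK frM (pcomp g f) = phom_mx frK frL f *m phom_mx frL frM g.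
Proof.
by apply: phom_mx_uniq => z x; rewrite pcompE !(phom_mxE frL frM, phom_mxE frK frL) mulmxA.
Qed.

Lemma phom_mx_id M n (dM : 'I_n -> grade N) (fr : frame M dM) :
  phom_mx fr fr (pid M) = 1%:M.
Proof. by apply: phom_mx_uniq => z x; rewrite mulmx1. Qed.

Lemma frame_piso L M n (d : 'I_n -> grade N) (frL : frame L d) (frM : frame M d) :
  piso L M.
Proof.
have h1 i j : (1%:M : 'M[F]_n) i j != 0 -> gle (d j) (d i).
  by rewrite mxE; case: (eqVneq i j) => [->|_]; rewrite ?gle_refl ?eqxx.
have [f hf] := phom_of_mx frL frM h1; have [g hg] := phom_of_mx frM frL h1.
exists f, g; split; [apply: (@phom_mx_inj _ _ _ _ _ _ frL frL)
                    |apply: (@phom_mx_inj _ _ _ _ _ _ frM frM)].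
  by rewrite (phom_mx_comp frL frM frL) hf hg phom_mx_id mulmx1.
by rewrite (phom_mx_comp frM frL frM) hf hg phom_mx_id mulmx1.
Qed.

Lemma frame_along_piso L M n (d : 'I_n -> grade N) :
  piso L M -> frame M d -> exists _ : frame L d, True.
Proof.
move=> [f [g [gf fg]]] fr.
have gfE z x : g z (f z x) = x := congr1 (fun h : phom _ _ => h z x) gf.
have fgE z x : f z (g z x) = x := congr1 (fun h : phom _ _ => h z x) fg.
unshelve eexists; last by [].
unshelve eapply (@Frame L n d (fun z => fco fr z \o f z)).
- by move=> z w h x /=; rewrite happ_nat fco_nat.
- by move=> z x y /= /fco_inj /(congr1 (g z)); rewrite !gfE.
- move=> z y; rewrite -(fco_img fr); split=> [[x <-]|[x <-]]; first by exists (f z x).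
  by exists (g z x); rewrite /= fgE.
Qed.

Lemma frame_pzero (d : 'I_0 -> grade N) : frame (pzero F N) d.
Proof.
unshelve eapply (@Frame (pzero F N) 0 d (fun z => (idfun : {linear 'rV[F]_0 -> 'rV[F]_0}))) => //=.
  by move=> z x y.
by move=> z y; split=> [_ []|_] //; exists y.
Qed.

Lemma frame_pF z : frame (pF F z) (fun _ : 'I_1 => z).
Proof.
unshelve eapply (@Frame (pF F z) 1 (fun=> z)
  (fun v => mulmxr (pid_mx 1 : 'M[F]_(gle z v, 1)))).
- move=> v w h; rewrite /pF /= => x; rewrite -mulmxA mul_pid_mx.
  case zv: (gle z v) x => x; last by rewrite [x]thinmx0 !mul0mx.
  by rewrite (gle_trans zv h).
- move=> v; rewrite /pF /=; case: (gle z v) => x y /=; last by rewrite [x]thinmx0 [y]thinmx0.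
  by rewrite pid_mx_1 !mulmx1.
- move=> v y; rewrite /pF /=; case: (gle z v); split=> //.
  + by move=> _; exists y; rewrite pid_mx_1 mulmx1.
  + by move=> [x <-] i _; rewrite [x]thinmx0 mul0mx mxE.
  + by move=> hy; exists 0; rewrite mul0mx; apply/rowP => i; rewrite mxE hy.
Qed.

Lemma frame_psum L M m n (dL : 'I_m -> grade N) (dM : 'I_n -> grade N)
    (d : 'I_(m + n) -> grade N) :
  (forall i, d (lshift n i) = dL i) -> (forall j, d (rshift m j) = dM j) ->
  frame L dL -> frame M dM -> frame (psum L M) d.
Proof.
move=> hL hM frL frM.
pose co z (x : psum L M z) : 'rV[F]_(m + n) := row_mx (fco frL z x.1) (fco frM z x.2).
have co_lin z : linear (co z).
  by move=> a x y; rewrite /co !linearP scale_row_mx add_row_mx.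
unshelve eapply (@Frame (psum L M) (m + n) d (fun z =>
  HB.pack (co z) (GRing.isLinear.Build F _ _ _ (co z) (co_lin z)))).
- by move=> z w h x; rewrite /= /co /= !fco_nat.
- by move=> z [x y] [x' y'] /eq_row_mx /= [/fco_inj -> /fco_inj ->].
- move=> z y /=; split=> [[[u v] <-]|hy].
    by move=> i; case: (split_ordP i) => j ->; rewrite ?hL ?hM => hj;
      rewrite /co ?row_mxEl ?row_mxEr fco0.
  have [u hu] : exists u, fco frL z u = lsubmx y.
    by apply/fco_img => j hj; rewrite mxE hy // hL.
  have [v hv] : exists v, fco frM z v = rsubmx y.
    by apply/fco_img => j hj; rewrite mxE hy // hM.
  by exists (u, v); rewrite /co /= hu hv hsubmxK.
Qed.

(** Transparent, because the coordinates on a dual module are compared with those of F(1), of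
    which F(1 - z) is a shift. *)
Definition frame_pshift M n (d : 'I_n -> grade N) z (fr : frame M d) :
  frame (pshift M z) (fun i => d i - z).
Proof.
unshelve eapply (@Frame (pshift M z) n _ (fun w => fco fr (w + z))).
- by move=> u v h x; exact: (fco_nat fr).
- move=> u x y xy. exact: (@fco_inj _ _ d fr (u + z) x y xy).
- move=> w y; rewrite (fco_img fr); split=> hy i hi; apply: hy; apply: contra hi.
    by move=> /(gleD2r (- z)); rewrite addrK.
  by move=> /(gleD2r z); rewrite subrK.
Defined.

Lemma finite_rank_free_frame M : finite_rank_free M ->
  exists n (d : 'I_n -> grade N) (_ : frame M d), True.
Proof.
move=> [s hs].
suff [n [d [fr _]]] : exists n (d : 'I_n -> grade N) (_ : frame (pfree F s) d), True.
  by have [fr' _] := frame_along_piso hs fr; exists n, d, fr'.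
elim: s {hs} => [|z s [n [d [fr _]]]] /=.
  exists 0, (fun=> 0); unshelve eexists; [exact: frame_pzero | by []].
pose d' (i : 'I_(1 + n)) := match split i with inl _ => z | inr j => d j end.
exists (1 + n)%N, d'; unshelve eexists => //.
apply: (frame_psum (dL := fun=> z) (dM := d)) (frame_pF z) fr => i; rewrite /d'.
  by rewrite (unsplitK (inl i)).
by rewrite (unsplitK (inr i)).
Qed.

Lemma frame_finite_rank_free M n (d : 'I_n -> grade N) :
  frame M d -> finite_rank_free M.
Proof.
move=> fr; suff [s [fr' _]] : exists s (_ : frame (pfree F s) d), True.
  by exists s; exact: frame_piso fr fr'.
elim: n d {M fr} => [|n IHn] d.
  by exists [::]; unshelve eexists; [exact: frame_pzero | by []].
have [s [fr _]] := IHn (fun i => d (rshift 1 i)).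
exists (d ord0 :: s); unshelve eexists => //=.
apply: (@frame_psum _ _ 1 n _ _ d) (frame_pF _) fr => // i.
by rewrite [i]ord1; congr d; apply: val_inj.
Qed.

(** ** Duals *)

Section DualFrame.
Context (M : pmod F N) (n : nat) (d : 'I_n -> grade N) (fr : frame M d).

Definition frame_unit (z : grade N) := frame_pshift z (frame_pF (grade1 N)).

(** An element of the dual at [z] is a morphism to F(1 - z), which has a single generator; its
    matrix is a column, the transpose of which lists the values on the generators. *)
Definition dual_co z (phi : gdual M z) : 'rV[F]_n :=
  (phom_mx fr (frame_unit z) phi)^T.

Lemma dual_co_linear z : linear (@dual_co z).
Proof. by move=> a f g; rewrite /dual_co phom_mx_linear linearP. Qed.

Lemma grade1_subC (u z : grade N) : gle (grade1 N - u) z = gle (grade1 N - z) u.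
Proof.
have key x y : gle (grade1 N - x) y -> gle (grade1 N - y) x.
  move=> /(gleD2r (x - y)); have -> : y + (x - y) = x by rewrite addrC subrK.
  by have -> : grade1 N - x + (x - y) = grade1 N - y by rewrite addrA subrK.
by apply/idP/idP; exact: key.
Qed.

HB.instance Definition _ z :=
  GRing.isLinear.Build F _ _ _ (@dual_co z) (@dual_co_linear z).

Lemma dual_co_nat z w (h : gle z w) phi :
  dual_co (pmap (gdual M) h phi) = dual_co phi.
Proof.
congr (_^T); apply: phom_mx_uniq => u y.
transitivity (fco (frame_pF (grade1 N)) (u + w)
  (pmap (pF F (grade1 N)) (gleD2l u h) (phi u y))); first by [].
rewrite fco_nat; exact: (phom_mxE fr (frame_unit z)).
Qed.

Lemma dual_co_img z (y : 'rV[F]_n) :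
  (exists phi : gdual M z, dual_co phi = y) <->
  forall i, ~~ gle (grade1 N - d i) z -> y 0 i = 0.
Proof.
split=> [[phi <-] i|hy].
  by rewrite grade1_subC mxE => hi; apply/eqP; apply: contraNT hi => /phom_mx_neq0.
have [|f hf] := @phom_of_mx _ _ _ _ _ _ fr (frame_unit z) y^T.
  move=> i j; rewrite mxE [j]ord1; apply: contraNT => hi.
  by rewrite hy // grade1_subC.
by exists f; rewrite /dual_co hf trmxK.
Qed.

Definition gdual_frame : frame (gdual M) (fun i => grade1 N - d i) :=
  @Frame (gdual M) n (fun i => grade1 N - d i) (fun z => @dual_co z)
    dual_co_nat (fun z x y h => @phom_mx_inj _ _ _ _ _ _ _ _ _ _ (trmx_inj h)) dual_co_img.

End DualFrame.

Lemma gdual_map_mx (L M : pmod F N) m n (dL : 'I_m -> grade N) (dM : 'I_n -> grade N)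
    (frL : frame L dL) (frM : frame M dM) (f : phom L M) :
  phom_mx (gdual_frame frM) (gdual_frame frL) (gdual_map f) = (phom_mx frL frM f)^T.
Proof.
apply: phom_mx_uniq => z phi /=.
by rewrite /dual_co (phom_mx_comp frL frM) trmx_mul.
Qed.

End Frames.

(** * Graded matrix complexes and their pieces *)

(** A complex of free modules in coordinates, acting on row vectors: the entry [D i a b] can be
    nonzero only if the grade of [b] is at most that of [a]. *)

Section MatrixComplex.
Context (F : fieldType) (N : nat) (n : nat -> nat).
Variables (g : forall i, 'I_(n i) -> grade N) (D : forall i, 'M[F]_(n i.+1, n i)).
Hypothesis DD : forall i, D i.+1 *m D i = 0.
Hypothesis Dg : forall i a b, D i a b != 0 -> gle (g b) (g a).

Implicit Types P Q A B : pred (grade N).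

Definition restr i P : 'M[F]_(n i) := diag_mx (\row_j (P (g j))%:R).

Definition no_arrow P Q := forall a b, gle b a -> P a -> Q b -> False.

Definition convex P := forall a b c, gle a b -> gle b c -> P a -> P c -> P b.

Lemma restrE i P (m : nat) (x : 'M_(m, n i)) a b :
  (x *m restr i P) a b = x a b * (P (g b))%:R.
Proof. by rewrite mul_mx_diag !mxE. Qed.

Lemma restrMl i P (m : nat) (x : 'M_(n i, m)) a b :
  (restr i P *m x) a b = (P (g a))%:R * x a b.
Proof. by rewrite mul_diag_mx !mxE. Qed.

Lemma eq_restr i P Q : (forall a, P (g a) = Q (g (i := i) a)) -> restr i P = restr i Q.
Proof. by move=> PQ; congr diag_mx; apply/rowP => a; rewrite !mxE PQ. Qed.

Lemma restrM i P Q : restr i P *m restr i Q = restr i (fun a => P a && Q a).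
Proof.
by rewrite mulmx_diag; congr diag_mx; apply/rowP => a; rewrite !mxE -natrM mulnb.
Qed.

Lemma restrMid i P : restr i P *m restr i P = restr i P.
Proof. by rewrite restrM; apply: eq_restr => a; rewrite andbb. Qed.

Lemma restrD i A B P : (forall a, P a = A a || B a) -> (forall a, ~~ (A a && B a)) ->
  restr i P = restr i A + restr i B.
Proof.
move=> hP hd; rewrite /restr -[RHS]linearD /=; congr diag_mx; apply/rowP => a.
rewrite !mxE hP; move: (hd (g a)); case: (A _); case: (B _) => //= _.
- by rewrite addr0.
- by rewrite add0r.
- by rewrite addr0.
Qed.

(** Only the pairs of generators whose grades are comparable matter for a truncated matrix; this
    reduces all identities between truncated matrices to inequalities between grades. *)
Lemma restr_diff_eq i P Q P' Q' :
  (forall a b, gle b a -> P a && Q b = P' a && Q' b) ->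
  restr i.+1 P *m D i *m restr i Q = restr i.+1 P' *m D i *m restr i Q'.
Proof.
move=> h; apply/matrixP => a b; rewrite !restrE !restrMl.
have [->|/Dg /h] := eqVneq (D i a b) 0; first by rewrite !(mulr0, mul0r).
by case: (P _); case: (Q _); case: (P' _); case: (Q' _) => //=; rewrite !(mulr0, mul0r).
Qed.

Lemma restr_diff0 i P Q : no_arrow P Q -> restr i.+1 P *m D i *m restr i Q = 0.
Proof.
move=> h; rewrite (@restr_diff_eq i P Q pred0 pred0).
  by rewrite -mulmxA (_ : restr i.+1 pred0 = 0) ?mul0mx // /restr;
    apply/matrixP => a b; rewrite !mxE mul0rn.
by move=> a b ba /=; apply/negP => /andP[]; exact: h.
Qed.

Definition supp P i (x : 'rV[F]_(n i)) := x *m restr i P = x.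

Lemma suppP P i (x : 'rV[F]_(n i)) :
  supp P x <-> forall a, ~~ P (g a) -> x 0 a = 0.
Proof.
split=> [<- a /negbTE Pa|h]; first by rewrite restrE Pa mulr0.
by apply/rowP => a; rewrite restrE; case: (boolP (P _)) => [_|/h ->]; rewrite ?mulr1 ?mulr0.
Qed.

Lemma supp_restr P i (x : 'rV[F]_(n i)) : supp P (x *m restr i P).
Proof. by rewrite /supp -mulmxA restrMid. Qed.

Lemma supp_sub P Q i (x : 'rV[F]_(n i)) : (forall a, P a -> Q a) -> supp P x -> supp Q x.
Proof. by move=> PQ /suppP h; apply/suppP => a /(contra (PQ _)); exact: h. Qed.

Lemma suppB P i (x y : 'rV[F]_(n i)) : supp P x -> supp P y -> supp P (x - y).
Proof. by rewrite /supp mulmxBl => -> ->. Qed.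

Lemma supp_disj P Q i (x : 'rV[F]_(n i)) : (forall a, ~~ (P a && Q a)) ->
  supp P x -> x *m restr i Q = 0.
Proof.
move=> h /suppP hx; apply/rowP => a; rewrite restrE mxE.
move: (h (g a)); case: (boolP (P _)) => [_ /= /negbTE ->|/hx -> _].
  by rewrite mulr0.
by rewrite mul0r.
Qed.

Definition pdiff P i (x : 'rV[F]_(n i.+1)) : 'rV[F]_(n i) := x *m D i *m restr i P.

Lemma pdiff_supp P i x : supp P (@pdiff P i x).
Proof. exact: supp_restr. Qed.

Lemma pdiffD P i : {morph @pdiff P i : x y / x + y}.
Proof. by move=> x y; rewrite /pdiff !mulmxDl. Qed.

Lemma pdiffB P i : {morph @pdiff P i : x y / x - y}.
Proof. by move=> x y; rewrite /pdiff !mulmxBl. Qed.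

(** A path of two nonzero entries with both ends in [P] stays in [P] by convexity, so the
    truncated square equals the truncation of [D i.+1 *m D i = 0]. *)
Lemma pdiff_pdiff P i x : convex P -> supp P x -> @pdiff P i (pdiff P x) = 0.
Proof.
move=> cP xP; have DD0 : x *m D i.+1 *m D i = 0 by rewrite -mulmxA DD mulmx0.
pose P' a := ~~ P a.
have e : 1%:M = restr i.+1 P + restr i.+1 P'.
  rewrite -(@restrD _ P P' predT) => [|a|a]; rewrite /P' ?orbN ?andbN //.
  by apply/matrixP => a b; rewrite !mxE.
have : x *m D i.+1 *m 1%:M *m D i *m restr i P = 0 by rewrite mulmx1 DD0 mul0mx.
rewrite e mulmxDr !mulmxDl => /eqP; rewrite addrC addr_eq0 => /eqP e0.
rewrite /pdiff -[LHS]opprK -e0; apply/eqP; rewrite oppr_eq0; apply/eqP.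
apply/rowP => c; rewrite restrE !mxE big_distrl big1 // => b _ /=.
rewrite restrE mxE !big_distrl big1 // => a _ /=.
have [->|/Dg ba] := eqVneq (D i.+1 a b) 0; first by rewrite !(mulr0, mul0r).
have [->|/Dg cb] := eqVneq (D i b c) 0; first by rewrite !(mulr0, mul0r).
have xa := (suppP P x).1 xP a.
case: (boolP (P (g a))) => [Pa|/xa ->]; last by rewrite !mul0r.
rewrite /P'; case: (boolP (P (g c))) => [Pc|]; last by rewrite !mulr0.
by rewrite (cP _ _ _ cb ba Pc Pa) !(mulr0, mul0r).
Qed.

(** The index [i] in [pcycle], [pbnd] and [acyclic] is one less than the degree in which homology
    is taken: the three consecutive degrees [i.+2], [i.+1], [i] are then all natural numbers. *)
Definition pcycle P i (x : 'rV[F]_(n i.+1)) := supp P x /\ pdiff P x = 0.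

Definition pbnd P i (x : 'rV[F]_(n i.+1)) :=
  (x <= restr i.+2 P *m D i.+1 *m restr i.+1 P)%MS.

Definition acyclic P i := forall x, @pcycle P i x -> pbnd P x.

Lemma pbndP P i x : @pbnd P i x <-> exists2 b, supp P b & x = pdiff P b.
Proof.
split=> [/submxP[b ->]|[b bP ->]].
  by exists (b *m restr _ P); rewrite ?/pdiff ?mulmxA //; exact: supp_restr.
by apply/submxP; exists b; rewrite !mulmxA bP.
Qed.

Lemma pcycleZD P i c x y : @pcycle P i x -> pcycle P y -> pcycle P (c *: x + y).
Proof.
move=> [xP x0] [yP y0]; split; first by rewrite /supp mulmxDl -scalemxAl xP yP.
by rewrite pdiffD y0 /pdiff -!scalemxAl -/(pdiff P x) x0 scaler0 addr0.
Qed.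

Lemma pbndN P i x : @pbnd P i (- x) = pbnd P x.
Proof. by rewrite /pbnd eqmx_opp. Qed.

Lemma acyclic_ext P Q i :
  (forall a, P (g a) = Q (g (i := i) a)) ->
  (forall a, P (g a) = Q (g (i := i.+1) a)) ->
  (forall a, P (g a) = Q (g (i := i.+2) a)) -> acyclic P i -> acyclic Q i.
Proof.
move=> /eq_restr h0 /eq_restr h1 /eq_restr h2 aP x.
by move: (aP x); rewrite /pcycle /supp /pdiff /pbnd h0 h1 h2.
Qed.

(** No arrow runs from [A] to [A'], so the piece of [A] is a subcomplex of that of [B], with
    the piece of [A'] as quotient. *)
Record extension A A' B : Prop := Extension {
  ext_union : forall a, B a = A a || A' a;
  ext_disj : forall a, ~~ (A a && A' a);
  ext_lower : no_arrow A A';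
  ext_convex_upper : convex A';
  ext_convex : convex B }.

(** ** The connecting map of an extension of pieces *)

Section Extension.
Variables A A' B : pred (grade N).
Hypothesis AB_ext : extension A A' B.

Let AA' := ext_disj AB_ext.
Let A'A a : ~~ (A' a && A a). Proof. by rewrite andbC; exact: AA'. Qed.
Let restrB i : restr i B = restr i A + restr i A' := restrD i (ext_union AB_ext) AA'.
Let AB a : A a -> B a. Proof. by rewrite (ext_union AB_ext) => ->. Qed.
Let A'B a : A' a -> B a. Proof. by rewrite (ext_union AB_ext) orbC => ->. Qed.

Lemma pdiff_split i x : @pdiff B i x = pdiff A x + pdiff A' x.
Proof. by rewrite /pdiff restrB mulmxDr. Qed.

Lemma pdiff_lower i x : supp A x -> @pdiff A' i x = 0.
Proof. by move=> xA; rewrite /pdiff -xA -mulmxA -mulmxA [restr _ _ *m _]mulmxA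
  restr_diff0 ?mulmx0 //; exact: ext_lower AB_ext. Qed.

Lemma pdiff_union_lower i x : supp A x -> @pdiff B i x = pdiff A x.
Proof. by move=> xA; rewrite pdiff_split pdiff_lower // addr0. Qed.

Lemma supp_split i (x : 'rV_(n i)) : supp B x ->
  exists x1 x2, [/\ supp A x1, supp A' x2 & x = x1 + x2].
Proof.
move=> xB; exists (x *m restr i A), (x *m restr i A'); split; try exact: supp_restr.
by rewrite -mulmxDr -restrB.
Qed.

(** For an extension, the differential of the piece of [B] is the block matrix of a mapping cone,
    with off-diagonal block [pdiff A] on the vectors supported on [A']: this block is the
    connecting map, from the homology of [A'] to that of [A] one degree lower. It is
    injective where the piece of [B] is acyclic, because [x - a] is then a cycle and thus a
    boundary of that piece. *)
Lemma cone_inj i x : acyclic B i.+1 -> @pcycle A' i.+1 x -> pbnd A (pdiff A x) -> pbnd A' x.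
Proof.
move=> aB [xA' x0] /pbndP[a aA ea].
have /aB/pbndP[b /supp_split[b1 [b2 [b1A b2A' ->]]] /(congr1 (mulmx^~ (restr _ A')))] :
    pcycle B (x - a).
  split; first by apply: suppB; [apply: supp_sub A'B _|apply: supp_sub AB _].
  by rewrite pdiffB (pdiff_union_lower aA) pdiff_split x0 addr0 ea subrr.
rewrite mulmxBl (supp_disj AA' aA) subr0 xA' pdiffD (pdiff_union_lower b1A) mulmxDl.
rewrite (supp_disj AA' (pdiff_supp _ _)) add0r pdiff_split mulmxDl.
rewrite (supp_disj AA' (pdiff_supp _ _)) add0r pdiff_supp => ->.
by apply/pbndP; exists b2.
Qed.

Lemma cone_pcycle i x : @pcycle A' i.+1 x -> pcycle A (pdiff A x).
Proof.
move=> [xA' x0]; split; first exact: pdiff_supp.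
have := pdiff_pdiff (ext_convex AB_ext) (supp_sub A'B xA').
by rewrite [pdiff B x]pdiff_split x0 addr0 pdiff_union_lower //; exact: pdiff_supp.
Qed.

(** The connecting map anticommutes with the differentials, which is the vanishing of the
    off-diagonal block in the square of the differential of the cone. *)
Lemma cone_pbnd i x : @pbnd A' i.+1 x -> pbnd A (pdiff A x).
Proof.
move=> /pbndP[b bA' ->]; rewrite -pbndN; apply/pbndP; exists (pdiff A b); first exact: pdiff_supp.
have := pdiff_pdiff (ext_convex AB_ext) (supp_sub A'B bA').
rewrite [pdiff B b]pdiff_split pdiffD pdiff_union_lower ?pdiff_split; last exact: pdiff_supp.
by rewrite (pdiff_pdiff (ext_convex_upper AB_ext) bA') addr0 => /eqP; rewrite addr_eq0 => /eqP ->.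
Qed.

(** A cycle [y] of [A] bounds some [b] in the piece of [B], and the part of [b] supported on [A'] is
    a preimage. *)
Lemma cone_surj i y : acyclic B i -> @pcycle A i y ->
  exists2 x, @pcycle A' i.+1 x & pbnd A (y - pdiff A x).
Proof.
move=> aB [yA y0].
have /aB/pbndP[b /supp_split[b1 [b2 [b1A b2A' ->]]]] : pcycle B y.
  by split; [apply: supp_sub AB _ | rewrite pdiff_union_lower].
rewrite pdiffD (pdiff_union_lower b1A) pdiff_split => yE; exists b2.
  split=> //; move/(congr1 (mulmx^~ (restr _ A'))): yE.
  rewrite (supp_disj AA' yA) !mulmxDl !(supp_disj AA' (pdiff_supp _ _)) !add0r pdiff_supp => /esym.
  exact.
have := congr1 (mulmx^~ (restr _ A)) yE.
rewrite yA !mulmxDl (supp_disj A'A (pdiff_supp _ _)) addr0 !pdiff_supp => ->.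
by rewrite addrK; apply/pbndP; exists b1.
Qed.

Lemma cone_acyclic i : acyclic B i.+1 -> acyclic A i -> acyclic A' i.+1.
Proof. by move=> aB aA x xc; apply: cone_inj => //; apply: aA; exact: cone_pcycle. Qed.

End Extension.

(** ** The staircase of pieces *)

(** The pieces [stair m v], for [m] from 0 to [N], interpolate between the complex at grade [v]
    and the dual of the dual complex at grade [- v]; [slab m v] is the union of two successive
    ones. *)
Definition stair (m : nat) (v b : grade N) : bool :=
  [forall j : 'I_N, if (j < m)%N then v j < b j else b j <= v j].

Definition slab (m : nat) (v b : grade N) : bool :=
  [forall j : 'I_N, ((j < m)%N ==> (v j < b j)) && ((m < j)%N ==> (b j <= v j))].

Lemma stairP m (v b : grade N) : reflect
  ((forall j : 'I_N, (j < m)%N -> v j < b j) /\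
   (forall j : 'I_N, (m <= j)%N -> b j <= v j)) (stair m v b).
Proof.
apply: (iffP forallP) => [h|[h1 h2] j].
  by split=> j jm; move: (h j); [rewrite jm | rewrite ltnNge jm].
by case: ltnP; [exact: h1 | exact: h2].
Qed.

Lemma slabP m (v b : grade N) : reflect
  ((forall j : 'I_N, (j < m)%N -> v j < b j) /\
   (forall j : 'I_N, (m < j)%N -> b j <= v j)) (slab m v b).
Proof.
apply: (iffP forallP) => [h|[h1 h2] j].
  by split=> j jm; have /andP[/implyP h1 /implyP h2] := h j; [exact: h1 | exact: h2].
by apply/andP; split; apply/implyP; [exact: h1 | exact: h2].
Qed.

Lemma stair_convex m v : convex (stair m v).
Proof.
move=> a b c /gleP ab /gleP bc /stairP[a1 _] /stairP[_ c2]; apply/stairP; split=> j jm.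
  exact: lt_le_trans (a1 j jm) (ab j).
exact: le_trans (bc j) (c2 j jm).
Qed.

Lemma slab_convex m v : convex (slab m v).
Proof.
move=> a b c /gleP ab /gleP bc /slabP[a1 _] /slabP[_ c2]; apply/slabP; split=> j jm.
  exact: lt_le_trans (a1 j jm) (ab j).
exact: le_trans (bc j) (c2 j jm).
Qed.

Lemma stair0 v b : stair 0 v b = gle b v.
Proof. by apply/stairP/gleP => [[_ h] j|h]; [exact: h | split]. Qed.

Lemma stair_disj m v a : (m < N)%N -> ~~ (stair m v a && stair m.+1 v a).
Proof.
move=> mN; apply/negP => /andP[/stairP[_ h] /stairP[h' _]].
have := h (Ordinal mN) (leqnn _); rewrite leNgt => /negP; apply.
exact: (h' (Ordinal mN) (ltnSn _)).
Qed.

Lemma slabE m v a : (m < N)%N -> slab m v a = stair m v a || stair m.+1 v a.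
Proof.
move=> mN; apply/slabP/orP => [[h1 h2]|[]/stairP[h1 h2]]; last first.
- by split=> j jm; [apply: h1; apply: ltnW | apply: h2].
- by split=> j jm; [exact: h1 | apply: h2; apply: ltnW].
have [am|am] := leP (a (Ordinal mN)) (v (Ordinal mN)); [left|right].
  apply/stairP; split=> // j; rewrite leq_eqVlt => /orP[/eqP mj|]; last exact: h2.
  by rewrite (_ : j = Ordinal mN) //; apply: val_inj.
apply/stairP; split=> // j; rewrite ltnS leq_eqVlt => /orP[/eqP mj|]; last exact: h1.
by rewrite (_ : j = Ordinal mN) //; apply: val_inj.
Qed.

Lemma stair_lower m v : (m < N)%N -> no_arrow (stair m v) (stair m.+1 v).
Proof.
move=> mN a b /gleP ba /stairP[_ h] /stairP[h' _].
have := le_trans (ba (Ordinal mN)) (h (Ordinal mN) (leqnn _)).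
by rewrite leNgt (h' (Ordinal mN) (ltnSn _)).
Qed.

Lemma stair_extension m v : (m < N)%N ->
  extension (stair m v) (stair m.+1 v) (slab m v).
Proof.
move=> mN; split; [by move=> a; exact: slabE | by move=> a; exact: stair_disj | | |].
- exact: stair_lower.
- exact: stair_convex.
- exact: slab_convex.
Qed.

Definition raise (m : nat) (c : int) (v : grade N) : grade N :=
  [ffun j : 'I_N => if j == m :> nat then c else v j].

(** Up to any finite bound on the grades of generators, forgetting the condition on the coordinate
    [m] amounts to raising the coordinate [m] of [v] above that bound. *)
Lemma slab_raise m c (v b : grade N) : (m < N)%N -> (forall j, b j <= c) ->
  slab m v b = stair m (raise m c v) b.
Proof.
move=> mN bc; apply/slabP/stairP => [[h1 h2]|[h1 h2]]; split=> j jm.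
- by rewrite ffunE ltn_eqF // h1.
- rewrite ffunE; case: eqP => // /eqP nm; apply: h2.
  by rewrite ltn_neqAle jm eq_sym nm.
- by move: (h1 j jm); rewrite ffunE ltn_eqF.
- by move: (h2 j (ltnW jm)); rewrite ffunE gtn_eqF.
Qed.

Lemma degree_bound i : exists c : int, forall a j, g (i := i) a j <= c.
Proof.
exists (\sum_a \sum_j `|g (i := i) a j|) => a j.
apply: le_trans (ler_norm _) _; rewrite (bigD1 a) //= (bigD1 j) //= -addrA lerDl.
by apply: addr_ge0; do ?[apply: sumr_ge0 => *]; rewrite ?normr_ge0 // sumr_ge0.
Qed.

(** The grade [u] bounds the supports of the [N + 1] homology modules under consideration. *)
Section Shifting.
Variable u : grade N.
Hypothesis acyc0 : forall i v, (i <= N)%N -> ~~ gle v u -> acyclic (stair 0 v) i.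

(** The raised grade is not below [u], whatever [v] is. *)
Lemma acyclic_slab m : (m < N)%N ->
  (forall i v, (m <= i <= N)%N -> ~~ gle v u -> acyclic (stair m v) i) ->
  forall i v, (m <= i <= N)%N -> acyclic (slab m v) i.
Proof.
move=> mN h i v hi.
have [c0 h0] := degree_bound i; have [c1 h1] := degree_bound i.+1.
have [c2 h2] := degree_bound i.+2.
(* [c] bounds the grades of all generators in the three degrees involved and exceeds [u]. *)
pose c := `|c0| + `|c1| + `|c2| + `|u (Ordinal mN)| + 1.
have [n0 n1 n2] : [/\ 0 <= `|c0|, 0 <= `|c1| & 0 <= `|c2|] by split.
have nu : 0 <= `|u (Ordinal mN)| by [].
have c0c : c0 <= c by rewrite (le_trans (ler_norm _)) // /c -!addrA lerDl !addr_ge0.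
have c1c : c1 <= c.
  by rewrite (le_trans (ler_norm _)) // /c [`|c0| + _]addrC -!addrA lerDl !addr_ge0.
have c2c : c2 <= c.
  by rewrite (le_trans (ler_norm _)) // /c [_ + `|c2|]addrC -!addrA lerDl !addr_ge0.
have uc : u (Ordinal mN) < c.
  rewrite ltzD1 (le_trans (ler_norm _)) // lerDr !addr_ge0 //.
apply: (@acyclic_ext (stair m (raise m c v))) => [a|a|a|].
- by rewrite (slab_raise (c := c)) // => j; exact: le_trans c0c.
- by rewrite (slab_raise (c := c)) // => j; exact: le_trans c1c.
- by rewrite (slab_raise (c := c)) // => j; exact: le_trans c2c.
apply: h => //; apply/negP => /gleP/(_ (Ordinal mN)).
by rewrite ffunE eqxx leNgt uc.
Qed.

Lemma acyclic_stair m : (m <= N)%N ->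
  forall i v, (m <= i <= N)%N -> ~~ gle v u -> acyclic (stair m v) i.
Proof.
elim: m => [|m IHm] mN i v; first by move=> /= iN; apply: acyc0.
case: i => // i /andP[mi iN] vu.
apply: (cone_acyclic (stair_extension v mN)).
- by apply: acyclic_slab (IHm (ltnW mN)) _ _ _ => //; rewrite iN ltnW.
- by apply: (IHm (ltnW mN)) => //; apply/andP; split=> //; exact: ltnW.
Qed.

Lemma acyclic_slab_range m : (m < N)%N ->
  forall i v, (m <= i <= N)%N -> acyclic (slab m v) i.
Proof. by move=> mN; apply: acyclic_slab => //; apply: acyclic_stair; apply: ltnW. Qed.

(** The composite of the connecting maps, from [stair m v] in degree [m.+1] down to [stair 0 v] in
    degree 1. *)
Fixpoint descent (v : grade N) (m : nat) : 'M[F]_(n m.+1, n 1) :=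
  match m with
  | 0%N => 1%:M
  | m'.+1 => D m'.+1 *m restr m'.+1 (stair m' v) *m descent v m'
  end.

Lemma descentS v m x :
  x *m descent v m.+1 = pdiff (stair m v) x *m descent v m.
Proof. by rewrite /= !mulmxA. Qed.

Lemma pbndD P i x y : @pbnd P i x -> pbnd P y -> pbnd P (x + y).
Proof. exact: addmx_sub. Qed.

Lemma pbndDr P i x y : @pbnd P i x -> pbnd P (y + x) -> pbnd P y.
Proof. by rewrite -pbndN => hx /pbndD/(_ hx); rewrite addrK. Qed.

Lemma descent_pcycle v m x : (m <= N)%N ->
  @pcycle (stair m v) m x -> @pcycle (stair 0 v) 0 (x *m descent v m).
Proof.
elim: m x => [|m IHm] x mN xc; first by rewrite mulmx1.
rewrite descentS; apply: IHm (ltnW mN) _.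
exact: (cone_pcycle (stair_extension v mN) xc).
Qed.

Lemma descent_pbnd v m x : (m <= N)%N ->
  @pbnd (stair m v) m x -> @pbnd (stair 0 v) 0 (x *m descent v m).
Proof.
elim: m x => [|m IHm] x mN xc; first by rewrite mulmx1.
rewrite descentS; apply: IHm (ltnW mN) _.
exact: (cone_pbnd (stair_extension v mN) xc).
Qed.

Lemma descent_inj v m x : (m <= N)%N -> @pcycle (stair m v) m x ->
  @pbnd (stair 0 v) 0 (x *m descent v m) -> pbnd (stair m v) x.
Proof.
elim: m x => [|m IHm] x mN xc; first by rewrite mulmx1.
rewrite descentS => /IHm h.
apply: (cone_inj (stair_extension v mN)) => //.
  by apply: acyclic_slab_range => //; rewrite mN (ltnW (ltnSn m)).
apply: h; first exact: ltnW.
exact: (cone_pcycle (stair_extension v mN) xc).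
Qed.

Lemma descent_surj v m y : (m <= N)%N -> @pcycle (stair 0 v) 0 y ->
  exists2 x, @pcycle (stair m v) m x & pbnd (stair 0 v) (y - x *m descent v m).
Proof.
elim: m => [|m IHm] mN yc.
  by exists y => //; rewrite mulmx1 subrr; exact: sub0mx.
have [x xc hx] := IHm (ltnW mN) yc.
have [|t tc ht] := cone_surj (stair_extension v mN) _ xc.
  by apply: acyclic_slab_range => //; rewrite leqnn (ltnW mN).
exists t => //; rewrite descentS.
have := pbndD hx (descent_pbnd (ltnW mN) ht).
by rewrite mulmxBl addrA subrK.
Qed.

(** Naturality of one connecting map in the grade. Restricting a cycle of [stair m.+1 v] to [w]
    before or after the connecting map differs by the boundary of its part whose coordinate [m] lies
    in the interval ]v_m, w_m]: exactly this part leaves [stair m.+1] and enters [stair m]. *)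
Lemma stair_restrict m v w x : (m < N)%N -> gle v w -> @pcycle (stair m.+1 v) m.+1 x ->
  pdiff (stair m w) (x *m restr _ (stair m.+1 w)) + pdiff (stair m w) (x *m restr _ (stair m w))
  = pdiff (stair m v) x *m restr _ (stair m w).
Proof.
move=> mN /gleP vw [xP x0].
rewrite -pdiffD -mulmxDr addrC -(@restrD _ (stair m w) (stair m.+1 w) (slab m w)); first last.
- by move=> a; exact: stair_disj.
- by move=> a; exact: slabE.
rewrite /pdiff -[in LHS]xP -[in RHS]xP.
have -> : x *m restr m.+2 (stair m.+1 v) *m restr m.+2 (slab m w) *m D m.+1
            *m restr m.+1 (stair m w)
          = x *m (restr m.+2 (stair m.+1 v) *m D m.+1 *m restr m.+1 (stair m w)).
  rewrite -!mulmxA [restr _ _ *m (restr _ _ *m _)]mulmxA restrM [restr _ _ *m (D _ *m _)]mulmxA.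
  congr (_ *m _); rewrite [in RHS]mulmxA; apply: restr_diff_eq => a b /gleP ba.
  apply: andb_id2r => /stairP[b1 b2]; apply: andb_idr => /stairP[a1 a2].
  apply/slabP; split=> j jm; first exact: lt_le_trans (b1 j jm) (ba j).
  exact: le_trans (a2 j jm) (vw j).
rewrite (@restr_diff_eq _ _ _ (stair m.+1 v)
   (fun b => stair m w b && (stair m v b || stair m.+1 v b))); last first.
  move=> a b /gleP ba; apply: andb_id2l => /stairP[a1 a2].
  apply/esym/andb_idr => /stairP[b1 b2]; rewrite -slabE //.
  apply/slabP; split=> j jm; first exact: le_lt_trans (vw j) (b1 j jm).
  exact: le_trans (ba j) (a2 j jm).
rewrite (@restrD m.+1 (fun b => stair m v b && stair m w b)
  (fun b => stair m.+1 v b && stair m w b)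
  (fun b => stair m w b && (stair m v b || stair m.+1 v b))); first last.
- by move=> a /=; rewrite andbACA (negbTE (stair_disj _ _ _)).
- by move=> a /=; rewrite andb_orr !(andbC (stair m w a)).
rewrite -!restrM !mulmxDr !mulmxA xP -/(pdiff (stair m.+1 v) x) x0 mul0mx addr0.
by [].
Qed.

Lemma descent_nat v w m x : (m <= N)%N -> gle v w -> @pcycle (stair m v) m x ->
  pbnd (stair 0 w) (x *m restr _ (stair m w) *m descent w m
                   - x *m descent v m).
Proof.
elim: m x => [|m IHm] x mN vw xc.
  rewrite !mulmx1; suff -> : x *m restr 1 (stair 0 w) = x by rewrite subrr; exact: sub0mx.
  apply: supp_sub xc.1 => a; rewrite !stair0 => av; exact: gle_trans vw.
rewrite !descentS.
have yc : pcycle (stair m v) (pdiff (stair m v) x).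
  exact: (cone_pcycle (stair_extension v mN) xc).
have := IHm _ (ltnW mN) vw yc.
rewrite -(stair_restrict mN vw xc) mulmxDl addrAC.
set s := pdiff (stair m w) (_ *m restr _ (stair m w)).
have : pbnd (stair 0 w) (s *m descent w m).
  apply: descent_pbnd (ltnW mN) _.
  by apply/pbndP; exists (x *m restr _ (stair m w)) => //; exact: supp_restr.
exact: pbndDr.
Qed.

End Shifting.

(** ** The pairing of cycles and cocycles *)

(** The row space of a matrix is the orthogonal of its kernel. *)
Lemma submx_orth (m1 m2 k : nat) (X : 'M[F]_(m1, k)) (Y : 'M[F]_(m2, k)) :
  (forall y : 'rV_k, y *m Y^T = 0 -> y *m X^T = 0) -> (X <= Y)%MS.
Proof.
move=> h; rewrite submxE; apply/eqP/trmx_inj; rewrite trmx_mul trmx0.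
apply/row_matrixP => i; rewrite row_mul row0; apply: h.
by rewrite -row_mul -trmx_mul mulmx_coker trmx0 row0.
Qed.

Lemma restr_tr i P : (restr i P)^T = restr i P.
Proof. exact: tr_diag_mx. Qed.

Definition pdiff_mx P i : 'M[F]_(n i.+1, n i) := restr i.+1 P *m D i *m restr i P.

Lemma pdiff_mxE P i x : supp P x -> x *m pdiff_mx P i = pdiff P x.
Proof. by move=> xP; rewrite /pdiff_mx !mulmxA xP. Qed.

Lemma supp_tr P i (x y : 'rV_(n i)) : supp P y -> y *m x^T = y *m (x *m restr i P)^T.
Proof. by move=> yP; rewrite trmx_mul restr_tr mulmxA yP. Qed.

(** The pairing of cycles with cocycles, that is with cycles of the transposed complex, is
    nondegenerate modulo boundaries and coboundaries: this and the next three lemmas. *)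
Lemma pcycle_orth P i x : @pcycle P i x ->
  (forall y, supp P y -> y *m (pdiff_mx P i.+1)^T = 0 -> y *m x^T = 0) -> pbnd P x.
Proof.
move=> [xP _] h; apply: submx_orth => y.
rewrite -[_ *m D i.+1 *m _]/(pdiff_mx P i.+1) => hy.
have -> : y *m x^T = y *m restr i.+1 P *m x^T by rewrite -mulmxA -{1}restr_tr -trmx_mul xP.
apply: h; first exact: supp_restr.
by rewrite -{1}restr_tr -mulmxA -trmx_mul /pdiff_mx -!mulmxA restrMid mulmxA.
Qed.

Lemma cocycle_orth P i (y : 'rV_(n i.+1)) : supp P y ->
  (forall x, @pcycle P i x -> y *m x^T = 0) -> (y <= (pdiff_mx P i)^T)%MS.
Proof.
move=> yP h; apply: submx_orth => x; rewrite trmxK => hx.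
apply: trmx_inj; rewrite trmx_mul trmxK trmx0 (supp_tr _ yP); apply: h.
split; first exact: supp_restr.
rewrite -pdiff_mxE; last exact: supp_restr.
by rewrite /pdiff_mx !mulmxA -[x *m _ *m _]mulmxA restrMid -!mulmxA [restr _ _ *m _]mulmxA.
Qed.

Lemma cocycle_pbnd0 P i x (y : 'rV_(n i.+1)) :
  @pbnd P i x -> y *m (pdiff_mx P i.+1)^T = 0 -> y *m x^T = 0.
Proof. by move=> /submxP[b ->] hy; rewrite trmx_mul mulmxA hy mul0mx. Qed.

Lemma coboundary_pcycle0 P i x (y : 'rV_(n i.+1)) :
  @pcycle P i x -> (y <= (pdiff_mx P i)^T)%MS -> y *m x^T = 0.
Proof.
move=> [xP x0] /submxP[b ->]; rewrite -mulmxA -trmx_mul pdiff_mxE // x0.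
by rewrite trmx0 mulmx0.
Qed.

(** ** Minimal complexes of bounded length *)

(** The pieces [face m v] compute the successive quotients by the [m] first variables: the
    piece of the grades equal to [v] in the first [m] coordinates and at most [v] in the others. *)
Definition face (m : nat) (v b : grade N) : bool :=
  [forall j : 'I_N, if (j < m)%N then b j == v j else b j <= v j].

Lemma faceP m (v b : grade N) : reflect
  ((forall j : 'I_N, (j < m)%N -> b j = v j) /\
   (forall j : 'I_N, (m <= j)%N -> b j <= v j)) (face m v b).
Proof.
apply: (iffP forallP) => [h|[h1 h2] j].
  by split=> j jm; move: (h j); [rewrite jm => /eqP | rewrite ltnNge jm].
by case: ltnP => jm; [rewrite h1 | exact: h2].
Qed.

Lemma face_convex m v : convex (face m v).
Proof.
move=> a b c /gleP ab /gleP bc /faceP[a1 a2] /faceP[c1 c2]; apply/faceP; split=> j jm.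
  by apply/eqP; rewrite eq_le -{1}(c1 j jm) -(a1 j jm) bc ab.
exact: le_trans (bc j) (c2 j jm).
Qed.

Lemma face0 v b : face 0 v b = gle b v.
Proof. by apply/faceP/gleP => [[_ h] j|h]; [exact: h | split]. Qed.

Lemma faceN v b : face N v b -> b = v.
Proof. by move=> /faceP[h _]; apply/ffunP => j; apply: h. Qed.

Definition lower (m : nat) (v : grade N) : grade N :=
  [ffun j : 'I_N => if j == m :> nat then v j - 1 else v j].

(** The short exact sequence of the multiplication by one variable, at grade [v]. *)
Lemma face_extension m v : (m < N)%N ->
  extension (face m (lower m v)) (face m.+1 v) (face m v).
Proof.
move=> mN; set jm := Ordinal mN; pose v' := lower m v.
have v'E j : v' j = if j == m :> nat then v j - 1 else v j by rewrite ffunE.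
have jmP (j : 'I_N) : m = j -> j = jm by move=> mj; apply: val_inj.
split; try exact: face_convex.
- move=> a; apply/faceP/orP => [[h1 h2]|[]/faceP[h1 h2]].
  + have := h2 jm (leqnn m); rewrite le_eqVlt => /orP[/eqP e|l]; [right|left].
      apply/faceP; split=> j; last by move=> /ltnW; exact: h2.
      by rewrite ltnS leq_eqVlt => /orP[/eqP/esym/jmP ->|]; [exact: e | exact: h1].
    apply/faceP; split=> j mj; rewrite v'E; first by rewrite ltn_eqF // h1.
    by case: eqP => [/esym/jmP ->|_]; [rewrite lerBrDr lezD1 | exact: h2].
  + split=> j mj; first by rewrite h1 // v'E ltn_eqF.
    have := h2 j mj; rewrite v'E; case: eqP => // _.
    by rewrite lerBrDr lezD1; exact: ltW.
  + split=> j mj; first exact/h1/ltnW.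
    by move: mj; rewrite leq_eqVlt => /orP[/eqP e|]; [rewrite h1 // -e | exact: h2].
- move=> a; apply/negP => /andP[/faceP[_ h] /faceP[h' _]].
  have := h jm (leqnn m); rewrite v'E eqxx (h' jm (ltnSn m)).
  by rewrite lerBrDr lezD1 ltxx.
- move=> a b /gleP ba /faceP[_ h] /faceP[h' _].
  have := le_trans (ba jm) (h jm (leqnn m)); rewrite v'E eqxx (h' jm (ltnSn m)).
  by rewrite lerBrDr lezD1 ltxx.
Qed.

Section Hilbert.
Hypothesis exact0 : forall i v, acyclic (face 0 v) i.
Hypothesis D_minimal : forall i a b, D i a b != 0 -> g a != g b.

(** Each variable costs one degree of acyclicity, through the connecting map. *)
Lemma acyclic_face m : (m <= N)%N -> forall i v, (m <= i)%N -> acyclic (face m v) i.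
Proof.
elim: m => [|m IHm] mN [|i] v mi //.
apply: (cone_acyclic (face_extension v mN)); first by apply: (IHm (ltnW mN)); exact: ltnW.
exact: (IHm (ltnW mN)).
Qed.

(** The piece of the grades equal to [v] has zero differential by minimality, so that it can be
    acyclic only if it is zero. *)
Lemma minimal_length i : (N <= i)%N -> n i.+1 = 0%N.
Proof.
move=> Ni; case en: (n i.+1) => [//|k].
have a : 'I_(n i.+1) by rewrite en; exact: ord0.
have pdiff0 j x : supp (face N (g a)) x -> @pdiff (face N (g a)) j x = 0.
  move=> xP; rewrite /pdiff -xP; apply/rowP => b; rewrite restrE !mxE.
  case: (boolP (face _ _ _)) => [/faceN gb|]; last by rewrite mulr0.
  rewrite mulr1 big1 // => c _; rewrite restrE.
  case: (boolP (face _ _ _)) => [/faceN gc|]; last by rewrite mulr0 mul0r.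
  have [->|/D_minimal] := eqVneq (D j c b) 0; first by rewrite mulr0.
  by rewrite gb gc eqxx.
have aP : supp (face N (g a)) (delta_mx 0 a : 'rV[F]_(n i.+1)).
  apply/suppP => b; rewrite mxE /=; have [->|//] := eqVneq b a; rewrite ?andbF //.
  by case/negP; apply/faceP.
have /pbndP[b bP] : pbnd (face N (g a)) (delta_mx 0 a : 'rV[F]_(n i.+1)).
  by apply: (acyclic_face (leqnn N) Ni); split=> //; exact: pdiff0.
rewrite pdiff0 // => /(congr1 (fun x : 'rV_(n i.+1) => x 0 a)).
by rewrite !mxE !eqxx => /eqP; rewrite oner_eq0.
Qed.

End Hilbert.
End MatrixComplex.

(** * Dual pairs *)

Section DualPairs.
Context (F : fieldType) (N : nat).
Implicit Types X Y : pmod F N.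

(** [dual_pair X Y] says that X and the graded dual of Y are paired perfectly, naturally in the
    grade. The pairing takes two grades with a proof that they are opposite, instead of a grade [z]
    and [- z], so that exchanging X and Y needs no transport along [- - z = z]. *)
Definition dual_pair X Y : Prop :=
  exists beta : forall z w : grade N, z + w = 0 -> X z -> Y w -> F,
    [/\ forall z w e a x x' y, beta z w e (a *: x + x') y = a * beta z w e x y + beta z w e x' y,
        forall z w e a x y y', beta z w e x (a *: y + y') = a * beta z w e x y + beta z w e x y',
        forall z w z' w' e e' (h : gle z z') (h' : gle w' w) x y,
          beta z' w' e' (pmap _ h x) y = beta z w e x (pmap _ h' y),
        forall z w e x, (forall y, beta z w e x y = 0) -> x = 0
      & forall z w e y, (forall x, beta z w e x y = 0) -> y = 0].

Lemma dual_pair_sym X Y : dual_pair X Y -> dual_pair Y X.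
Proof.
move=> [b [bl br bn bX bY]].
have ec (z w : grade N) : z + w = 0 -> w + z = 0 by rewrite addrC.
exists (fun z w e y x => b w z (ec _ _ e) x y); split.
- by move=> z w e a x x' y; exact: br.
- by move=> z w e a x y y'; exact: bl.
- by move=> z w z' w' e e' h h' x y; apply/esym; exact: bn.
- by move=> z w e x hx; apply: (bY _ _ (ec _ _ e)).
- by move=> z w e x hx; apply: (bX _ _ (ec _ _ e)).
Qed.

Lemma dual_pair_zero X Y : dual_pair X Y -> is_zero X -> is_zero Y.
Proof.
move=> [b [bl _ _ _ bY]] X0 w y.
have e : - w + w = 0 by rewrite addNr.
apply: (bY _ _ e) => x; rewrite [x]X0.
have := bl _ _ e 0 0 0 y; rewrite scaler0 addr0 mul0r add0r.
have := bl _ _ e 1 0 0 y; rewrite scaler0 addr0 mul1r => h _.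
by apply/eqP; rewrite -(inj_eq (addrI (b _ _ e 0 y))) -h addr0.
Qed.

(** In finite dimension, nondegeneracy on one side makes every functional on that side
    representable: the row of values of [l] is orthogonal to the kernel of the Gram matrix. *)
Lemma bilinear_represent (V W : lmodType F) (b : V -> W -> F) (l : W -> F) :
  (forall a x x' y, b (a *: x + x') y = a * b x y + b x' y) ->
  (forall a x y y', b x (a *: y + y') = a * b x y + b x y') ->
  (forall y, (forall x, b x y = 0) -> y = 0) ->
  (forall a y y', l (a *: y + y') = a * l y + l y') ->
  fin_dim V -> fin_dim W -> exists x, forall y, b x y = l y.
Proof.
move=> bl br bW ll [m [u hu]] [n [e he]].
pose fr x : {linear W -> F^o} :=
  HB.pack (b x : W -> F^o) (GRing.isLinear.Build F W F^o _ (b x) (fun a => br a x)).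
pose fl y : {linear V -> F^o} :=
  HB.pack (b^~ y : V -> F^o) (GRing.isLinear.Build F V F^o _ (b^~ y) (fun a x x' => bl a x x' y)).
pose fl' : {linear W -> F^o} :=
  HB.pack (l : W -> F^o) (GRing.isLinear.Build F W F^o _ l ll).
have br_sum x (c : 'I_n -> F) : b x (\sum_j c j *: e j) = \sum_j c j * b x (e j).
  by rewrite -[LHS]/(fr x _) linear_sum; apply: eq_bigr => j _; rewrite linearZ.
have bl_sum y (c : 'I_m -> F) : b (\sum_i c i *: u i) y = \sum_i c i * b (u i) y.
  by rewrite -[LHS]/(fl y _) linear_sum; apply: eq_bigr => j _; rewrite linearZ.
have l_sum (c : 'I_n -> F) : l (\sum_j c j *: e j) = \sum_j c j * l (e j).
  by rewrite -[LHS]/(fl' _) linear_sum; apply: eq_bigr => j _; rewrite linearZ.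
pose A : 'M[F]_(m, n) := \matrix_(i, j) b (u i) (e j).
have /submxP[c hc] : (\row_j l (e j) <= A)%MS.
  apply: submx_orth => y yA.
  have y0 : \sum_j y 0 j *: e j = 0.
    apply: bW => x; have [a ->] := hu x; rewrite bl_sum big1 // => i _.
    rewrite br_sum; have /rowP/(_ i) := yA; rewrite !mxE => h.
    rewrite (_ : \sum_j _ = 0) ?mulr0 // -[RHS]h.
    by apply: eq_bigr => j _; rewrite !mxE.
  apply/rowP => k; rewrite !mxE; have := l_sum (y 0).
  rewrite y0 (linear0 fl' : l 0 = 0) => /esym h; rewrite -[RHS]h.
  by apply: eq_bigr => j _; rewrite !mxE.
exists (\sum_i c 0 i *: u i) => y; have [a ->] := he y.
rewrite br_sum l_sum; apply: eq_bigr => j _; congr (_ * _).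
have /rowP/(_ j) := hc; rewrite !mxE bl_sum => ->.
by apply: eq_bigr => i _; rewrite mxE.
Qed.

(** Two modules with the same dual are isomorphic: relate the elements that define the same
    functional on Y. *)
Lemma dual_pair_piso X X' Y : dual_pair X Y -> dual_pair X' Y ->
  pfd X -> pfd X' -> pfd Y ->
  exists (f : phom X X') (g : phom X' X), pcomp g f = pid X /\ pcomp f g = pid X'.
Proof.
move=> [b [bl br bn bX bY]] [b' [bl' br' bn' bX' bY']] fX fX' fY.
pose R z (x : X z) (x' : X' z) := forall w e y, b z w e x y = b' z w e x' y.
have [||||||f [g [gf fg _]]] := @rel_piso _ _ X X' R; last by exists f, g.
- by move=> z a x y x' y' h h' w e t; rewrite bl bl' h h'.
- move=> z z' h x x' hx w e y.
  have h' : gle w (- z).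
    have /(gleD2r (- z - z')) := h; rewrite addrA subrr sub0r.
    have -> : z' + (- z - z') = - z by rewrite addrCA subrr addr0.
    by rewrite -[w]add0r -(addNr z') -addrA e addr0.
  by rewrite (bn _ _ _ _ (subrr z) e h h') (bn' _ _ _ _ (subrr z) e h h') hx.
- move=> z x.
  have [x' hx'] := @bilinear_represent _ _ _ (b z _ (subrr z) x) (bl' z _ (subrr z))
    (br' z _ (subrr z)) (bY' z _ (subrr z)) (fun a => br z _ (subrr z) a x) (fX' z) (fY _).
  exists x' => w e; have ew : w = - z by apply/eqP; rewrite -addr_eq0 addrC e.
  by subst w => y; rewrite (Prop_irrelevance e (subrr z)) hx'.
- move=> z x.
  have [x' hx'] := @bilinear_represent _ _ _ (b' z _ (subrr z) x) (bl z _ (subrr z))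
    (br z _ (subrr z)) (bY z _ (subrr z)) (fun a => br' z _ (subrr z) a x) (fX z) (fY _).
  exists x' => w e; have ew : w = - z by apply/eqP; rewrite -addr_eq0 addrC e.
  by subst w => y; rewrite (Prop_irrelevance e (subrr z)) hx'.
- move=> z y hy; apply: (bX' z _ (subrr z)) => t; rewrite -hy.
  have := bl z _ (subrr z) 1 0 0 t; rewrite scaler0 addr0 mul1r => h.
  by apply: (addrI (b z _ (subrr z) 0 t)); rewrite -h addr0.
- move=> z x hx; apply: (bX z _ (subrr z)) => t; rewrite hx.
  have := bl' z _ (subrr z) 1 0 0 t; rewrite scaler0 addr0 mul1r => h.
  by apply: (addrI (b' z _ (subrr z) 0 t)); rewrite -h addr0.
Qed.

(** To pair homology classes it suffices to pair representing vectors, when the value does not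
    depend on the representatives. Here [RX] and [RY] relate classes to their representatives. *)
Lemma dual_pair_of_rel X Y k (RX : forall z, X z -> 'rV[F]_k -> Prop)
    (RY : forall z, Y z -> 'rV[F]_k -> Prop) :
  (forall z q, exists x, RX z q x) -> (forall w q, exists y, RY w q y) ->
  (forall z a q q' x x', RX z q x -> RX z q' x' -> RX z (a *: q + q') (a *: x + x')) ->
  (forall z a q q' x x', RY z q x -> RY z q' x' -> RY z (a *: q + q') (a *: x + x')) ->
  (forall z w q x y, z + w = 0 -> RX z 0 x -> RY w q y -> y *m x^T = 0) ->
  (forall z w q x y, z + w = 0 -> RX z q x -> RY w 0 y -> y *m x^T = 0) ->
  (forall z w z' w' (h : gle z z') (h' : gle w' w) q q' x y, z + w = 0 -> z' + w' = 0 ->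
     RX z q x -> RY w' q' y -> exists x',
     [/\ RX z' (pmap _ h q) x', RY w (pmap _ h' q') y & y *m x'^T = y *m x^T]) ->
  (forall z w q x, z + w = 0 -> RX z q x ->
     (forall q' y, RY w q' y -> y *m x^T = 0) -> q = 0) ->
  (forall z w q y, z + w = 0 -> RY w q y ->
     (forall q' x, RX z q' x -> y *m x^T = 0) -> q = 0) ->
  dual_pair X Y.
Proof.
move=> Xtot Ytot Xlin Ylin X0 Y0 nat ndX ndY.
pose cx z q := projT1 (cid (Xtot z q)); pose cy z q := projT1 (cid (Ytot z q)).
have cxP z q : RX z q (cx z q) by rewrite /cx; case: cid.
have cyP z q : RY z q (cy z q) by rewrite /cy; case: cid.
have sub (Z : pmod F N) (R : forall z, Z z -> 'rV[F]_k -> Prop) z q x x' :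
    (forall z a q q' x x', R z q x -> R z q' x' -> R z (a *: q + q') (a *: x + x')) ->
    R z q x -> R z q x' -> R z 0 (x - x').
  move=> h Rx Rx'; have := h _ (-1) _ _ _ _ Rx' Rx.
  by rewrite !scaleN1r addNr [- _ + _]addrC.
pose b z w (_ : z + w = 0) q q' := (cy w q' *m (cx z q)^T) 0 0.
have bE z w e q q' x y : RX z q x -> RY w q' y -> b z w e q q' = (y *m x^T) 0 0.
  move=> hx hy; rewrite /b.
  have /eqP := X0 _ _ _ _ _ e (sub _ _ _ _ _ _ Xlin (cxP z q) hx) (cyP w q').
  rewrite linearB mulmxBr subr_eq0 => /eqP ->.
  have /eqP := Y0 _ _ _ _ _ e hx (sub _ _ _ _ _ _ Ylin (cyP w q') hy).
  by rewrite mulmxBl subr_eq0 => /eqP ->.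
have sc (A : 'M[F]_1) : A 0 0 = 0 -> A = 0.
  by move=> h; apply/matrixP => i j; rewrite !ord1 h mxE.
exists b; split.
- move=> z w e a x x' y.
  rewrite (bE _ _ _ _ _ _ _ (Xlin _ a _ _ _ _ (cxP z x) (cxP z x')) (cyP w y)).
  by rewrite linearP mulmxDr -scalemxAr mxE [X in X + _]mxE.
- move=> z w e a x y y'.
  rewrite (bE _ _ _ _ _ _ _ (cxP z x) (Ylin _ a _ _ _ _ (cyP w y) (cyP w y'))).
  by rewrite mulmxDl -scalemxAl mxE [X in X + _]mxE.
- move=> z w z' w' e e' h h' x y.
  have [x' [h1 h2 h3]] := nat _ _ _ _ h h' _ _ _ _ e e' (cxP z x) (cyP w' y).
  by rewrite (bE _ _ _ _ _ _ _ h1 (cyP w' y)) (bE _ _ _ _ _ _ _ (cxP z x) h2) h3.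
- move=> z w e x hx; apply: (ndX _ _ _ _ e (cxP z x)) => q' y hy.
  by apply: sc; rewrite -(bE _ _ e _ _ _ _ (cxP z x) hy).
- move=> z w e y hy; apply: (ndY _ _ _ _ e (cyP w y)) => q' x hx.
  by apply: sc; rewrite -(bE _ _ e _ _ _ _ hx (cyP w y)).
Qed.

End DualPairs.

(** * Homology in coordinates *)

Section Classes.
Context (F : fieldType) (N : nat) (K L M : pmod F N) (f : phom K L) (h : phom L M).
Context (k l m : nat) (dK : 'I_k -> grade N) (dL : 'I_l -> grade N) (dM : 'I_m -> grade N).
Context (frK : frame K dK) (frL : frame L dL) (frM : frame M dM).

(** The class [q] contains a cycle with coordinates [x]. *)
Definition represents z (q : phomology f h z) (x : 'rV[F]_l) : Prop :=
  exists2 c : hker h z, hpi f c = q & fco frL z (val c) = x.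

Lemma hpi0 z (c : hker h z) : hpi f c = 0 <-> exists y, f z y = val c.
Proof.
have e0 : hpi f (0 : hker h z) = 0 by exact: linear0.
split=> [hc|hy]; last first.
  by rewrite -e0; apply/lpiE; rewrite inE subr0; exact/asboolP.
have /lpiE : hpi f c = hpi f 0 by rewrite hc e0.
by rewrite inE subr0 => /asboolP.
Qed.

Lemma represents_tot z q : exists x, @represents z q x.
Proof. by exists (fco frL z (val (repr q))), (repr q); rewrite ?hpi_repr. Qed.

Lemma represents_lin z a q q' x x' : @represents z q x -> represents q' x' ->
  @represents z (a *: q + q') (a *: x + x').
Proof.
by move=> [c <- <-] [c' <- <-]; exists (a *: c + c'); [exact: hpi_linear | rewrite -linearP].
Qed.

Lemma represents_nat z w (zw : gle z w) q x : @represents z q x -> @represents w (pmap _ zw q) x.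
Proof.
by move=> [c <- <-]; exists (hker_map zw c); rewrite /= ?hmapE ?fco_nat.
Qed.

Lemma represents_cycle z q x : @represents z q x ->
  (forall i, ~~ gle (dL i) z -> x 0 i = 0) /\ x *m phom_mx frL frM h = 0.
Proof.
move=> [[c /= hc] _ <-]; split=> [i|]; first exact: fco0.
by move: hc; rewrite inE -phom_mxE => /eqP ->; rewrite linear0.
Qed.

Lemma represents_ex z (x : 'rV[F]_l) : (forall i, ~~ gle (dL i) z -> x 0 i = 0) ->
  x *m phom_mx frL frM h = 0 -> exists q, @represents z q x.
Proof.
move=> /(fco_img frL)[c <-]; rewrite -phom_mxE -(linear0 (fco frM z)) => /fco_inj hc.
have hc' : c \in kernel_pred (h z) by rewrite inE hc.
by exists (hpi f (Kernel hc')), (Kernel hc').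
Qed.

Lemma represents0 z q x : @represents z q x -> (q = 0 <-> exists2 t : 'rV[F]_k,
  forall i, ~~ gle (dK i) z -> t 0 i = 0 & x = t *m phom_mx frK frL f).
Proof.
move=> [c <- <-]; rewrite hpi0; split=> [[y <-]|[t /(fco_img frK)[y <-]]].
  by exists (fco frK z y) => [i|]; [exact: fco0 | exact: phom_mxE].
by rewrite -phom_mxE => /fco_inj e; exists y.
Qed.

End Classes.

(** * Duality *)

(** The complex is indexed by natural numbers: the duality concerns the [N + 3] consecutive modules
    from which the homology in degrees 1 to [N + 1] is computed. *)
Section Ladder.
Context (F : fieldType) (N : nat) (X : nat -> pmod F N).
Context (dX : forall m, phom (X m.+1) (X m)).
Hypothesis dXdX : forall m, pcomp (dX m) (dX m.+1) = 0.
Context (n : nat -> nat) (g : forall m, 'I_(n m) -> grade N).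
Context (fr : forall m, frame (X m) (g (m := m))).

Let D m := phom_mx (fr m.+1) (fr m) (dX m).

Let DD m : D m.+1 *m D m = 0.
Proof. by rewrite /D -phom_mx_comp dXdX phom_mx0. Qed.

Let Dg m a b : D m a b != 0 -> gle (g b) (g a).
Proof. exact: phom_mx_neq0. Qed.

Lemma supp_stair0 m z (x : 'rV[F]_(n m)) :
  supp g (stair 0 z) x <-> forall i, ~~ gle (g i) z -> x 0 i = 0.
Proof. by rewrite suppP; split=> h i; have := h i; rewrite stair0. Qed.

Lemma restrT m : restr F g m predT = 1%:M.
Proof. by apply/matrixP => i j; rewrite !mxE. Qed.

(** The generators below [z] span a subcomplex, so truncating the target is automatic. *)
Lemma restr_stair0 m z : restr F g m.+1 (stair 0 z) *m D m = pdiff_mx g D (stair 0 z) m.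
Proof.
rewrite -[LHS]mulmx1 -restrT; apply: (restr_diff_eq Dg) => a b ba; rewrite !stair0 /= andbT.
by apply/esym/andb_idr; exact: gle_trans.
Qed.

Lemma pdiff_stair0 m z (x : 'rV[F]_(n m.+1)) : supp g (stair 0 z) x ->
  pdiff g D (stair 0 z) x = x *m D m.
Proof. by move=> xP; rewrite -pdiff_mxE // -restr_stair0 mulmxA xP. Qed.

Lemma represents_pcycle m z q (x : 'rV[F]_(n m.+1)) :
  represents (fr m.+1) (q : phomology (dX m.+1) (dX m) z) x ->
  pcycle g D (stair 0 z) x.
Proof.
move=> /(represents_cycle (fr m))[/supp_stair0 xP x0]; split=> //.
by rewrite pdiff_stair0.
Qed.

Lemma pcycle_represents m z (x : 'rV[F]_(n m.+1)) : pcycle g D (stair 0 z) x ->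
  exists q, represents (fr m.+1) (q : phomology (dX m.+1) (dX m) z) x.
Proof.
move=> [xP]; rewrite pdiff_stair0 // => x0.
by apply: (represents_ex _ _ (frM := fr m)) => //; apply/supp_stair0.
Qed.

Lemma represents_pbnd m z q (x : 'rV[F]_(n m.+1)) :
  represents (fr m.+1) (q : phomology (dX m.+1) (dX m) z) x ->
  (q = 0 <-> pbnd g D (stair 0 z) x).
Proof.
move=> /(represents0 (fr m.+2)) ->; rewrite pbndP; split=> -[t tP ->]; exists t.
- exact/supp_stair0.
- by rewrite pdiff_stair0 //; exact/supp_stair0.
- exact/supp_stair0.
- by rewrite pdiff_stair0.
Qed.

Lemma acyclic_homology m z :
  (forall q : phomology (dX m.+1) (dX m) z, q = 0) -> acyclic g D (stair 0 z) m.
Proof. by move=> q0 x /pcycle_represents[q hq]; apply/(represents_pbnd hq). Qed.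

Lemma common_bound :
  (forall m, (m <= N)%N -> eventually_vanishes (phomology (dX m.+1) (dX m))) ->
  exists u, forall m v, (m <= N)%N -> ~~ gle v u -> acyclic g D (stair 0 v) m.
Proof.
move=> ev; have ev' (m : 'I_N.+1) : exists u : grade N, forall z,
    (exists x : phomology (dX m.+1) (dX m) z, x != 0) -> gle z u.
  by apply: ev; rewrite -ltnS.
have [u hu] := choice ev'.
exists [ffun j => \sum_m `|u m j|] => m v; rewrite -ltnS => mN vu.
apply: acyclic_homology => q; apply: contraNeq vu => q0.
have /gleP h := hu (Ordinal mN) v (ex_intro _ q q0).
apply/gleP => j; rewrite ffunE; apply: le_trans (h j) _.
apply: le_trans (ler_norm _) _; rewrite (bigD1 (Ordinal mN)) //= lerDl.
by apply: sumr_ge0.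
Qed.

(** This is where the shift by 1 in the global dual enters: b > z in all coordinates means
    b >= z + 1. *)
Lemma stairN z w (b : grade N) : z + w = 0 -> gle (grade1 N - b) w = stair N z b.
Proof.
move=> e; have {e} -> : w = - z by apply/eqP; rewrite -addr_eq0 addrC e.
apply/gleP/stairP => [h|[h _] j]; last first.
  by rewrite !ffunE lerBlDr addrC -lerBlDr opprK addrC lezD1 h.
split=> j; last by rewrite leqNgt ltn_ord.
by move=> _; have := h j; rewrite !ffunE lerBlDr addrC -lerBlDr opprK addrC lezD1.
Qed.

(** Dually to [restr_stair0], the generators above [z] span a subcomplex of the transposed
    complex. *)
Lemma restr_stairN m z : D m *m restr F g m (stair N z) = pdiff_mx g D (stair N z) m.
Proof.
rewrite -[D m in LHS]mul1mx -restrT; apply: (restr_diff_eq Dg) => a b /gleP ba /=.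
apply/esym/andb_idl => /stairP[h _]; apply/stairP; split=> j.
  by move=> jN; apply: lt_le_trans (h j jN) (ba j).
by rewrite leqNgt ltn_ord.
Qed.

Let dual_represents w (q : phomology (gdual_map (dX N)) (gdual_map (dX N.+1)) w) y :=
  represents (gdual_frame (fr N.+1)) q y.

Lemma supp_stairN m z w (y : 'rV[F]_(n m)) : z + w = 0 ->
  supp g (stair N z) y <-> forall i, ~~ gle (grade1 N - g i) w -> y 0 i = 0.
Proof. by move=> e; rewrite suppP; split=> h i; have := h i; rewrite (stairN _ e). Qed.

Lemma dual_represents_cocycle z w q y : z + w = 0 -> @dual_represents w q y ->
  supp g (stair N z) y /\ y *m (pdiff_mx g D (stair N z) N.+1)^T = 0.
Proof.
move=> e /(represents_cycle (gdual_frame (fr N.+2)))[/(supp_stairN _ e) yP].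
rewrite gdual_map_mx => y0; split=> //.
by rewrite -restr_stairN trmx_mul restr_tr mulmxA yP.
Qed.

Lemma cocycle_dual_represents z w y : z + w = 0 -> supp g (stair N z) y ->
  y *m (pdiff_mx g D (stair N z) N.+1)^T = 0 -> exists q, @dual_represents w q y.
Proof.
move=> e yP y0; apply: (represents_ex _ _ (frM := gdual_frame (fr N.+2))).
  by apply/(supp_stairN _ e).
by rewrite gdual_map_mx -[RHS]y0 -restr_stairN trmx_mul restr_tr mulmxA yP.
Qed.

Lemma dual_represents0 z w q y : z + w = 0 -> @dual_represents w q y ->
  (q = 0 <-> (y <= (pdiff_mx g D (stair N z) N)^T)%MS).
Proof.
move=> e /(represents0 (gdual_frame (fr N))) ->; rewrite gdual_map_mx -restr_stairN trmx_mul restr_tr.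
split=> [[t /(supp_stairN _ e) tP ->]|/submxP[t ->]].
  by apply/submxP; exists t; rewrite mulmxA tP.
exists (t *m restr F g N (stair N z)); last by rewrite mulmxA.
by apply/(supp_stairN _ e); exact: supp_restr.
Qed.

Lemma restr_stairN_mono m z w : gle z w ->
  restr F g m (stair N z) *m restr F g m (stair N w) = restr F g m (stair N w).
Proof.
move=> /gleP zw; rewrite restrM; apply: eq_restr => a; apply: andb_idl.
move=> /stairP[h _]; apply/stairP; split=> j jN; last by move: jN; rewrite leqNgt ltn_ord.
exact: le_lt_trans (zw j) (h j jN).
Qed.

Lemma pbnd_stair0_mono m z w (x : 'rV[F]_(n m.+1)) :
  gle z w -> pbnd g D (stair 0 z) x -> pbnd g D (stair 0 w) x.
Proof.
move=> zw /pbndP[t tP ->]; have tP' : supp g (stair 0 w) t.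
  by apply: supp_sub tP => a; rewrite !stair0 => az; exact: gle_trans zw.
by apply/pbndP; exists t; rewrite // !pdiff_stair0.
Qed.

(** A homology class of X in degree 1 at [z] is represented by a cycle of [stair N z] in degree
    [N.+1] whose [descent] lies in that class, and a cohomology class at [- z] by the values of a
    cocycle on the generators in [stair N z]. The pairing is the scalar product of the two
    vectors. *)
Lemma homology_duality :
  (forall m, (m <= N)%N -> eventually_vanishes (phomology (dX m.+1) (dX m))) ->
  dual_pair (phomology (dX 1) (dX 0)) (phomology (gdual_map (dX N)) (gdual_map (dX N.+1))).
Proof.
move=> /common_bound[u acyc0].
pose hrep z (q : phomology (dX 1) (dX 0) z) x := represents (fr 1) q x.
pose RX z (q : phomology (dX 1) (dX 0) z) (x : 'rV[F]_(n N.+1)) :=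
  pcycle g D (stair N z) x /\
  exists2 c, @hrep z q c & pbnd g D (stair 0 z) (x *m descent g D z N - c).
have RX0 z q x : RX z q x -> (q = 0 <-> pbnd g D (stair N z) x).
  move=> [xc [c hc b]]; rewrite (represents_pbnd hc); split=> h.
    apply: (descent_inj DD Dg acyc0 (leqnn N) xc).
    by have := pbndD b h; rewrite subrK.
  have := descent_pbnd DD Dg (leqnn N) h.
  by move: b; rewrite -pbndN opprB => b /pbndD/(_ b); rewrite addrC subrK.
apply: (@dual_pair_of_rel _ _ _ _ _ RX (fun w q y => @dual_represents w q y)).
- move=> z q; have [c hc] := represents_tot (fr 1) q.
  have [x xc b] := descent_surj DD Dg acyc0 (leqnn N) (represents_pcycle hc).
  by exists x; split=> //; exists c => //; rewrite -pbndN opprB.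
- by move=> w q; exact: represents_tot.
- move=> z a q q' x x' [xc [c hc b]] [xc' [c' hc' b']].
  split; first exact: pcycleZD.
  exists (a *: c + c'); first exact: represents_lin.
  rewrite mulmxDl -scalemxAl opprD addrACA -scalerBr; apply: pbndD b'.
  exact: scalemx_sub.
- by move=> w a q q' x x'; exact: represents_lin.
- move=> z w q x y e /RX0[h _] /(dual_represents_cocycle e)[_ y0].
  by apply: (cocycle_pbnd0 (h erefl)).
- move=> z w q x y e [xc _] hy; have [h _] := dual_represents0 e hy.
  exact: (coboundary_pcycle0 xc (h erefl)).
- move=> z w z' w' h h' q q' x y e e' [xc [c hc b]] hy.
  have [yP _] := dual_represents_cocycle e' hy.
  exists (x *m restr F g N.+1 (stair N z')); split; last first.
  + by rewrite -(supp_tr _ yP).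
  + exact: represents_nat.
  split; last first.
    exists c; first exact: represents_nat.
    by have := pbndD (descent_nat DD Dg (leqnn N) h xc) (pbnd_stair0_mono h b); rewrite addrA subrK.
  split; first exact: supp_restr.
  rewrite -pdiff_mxE; last exact: supp_restr.
  have -> : x *m restr F g N.+1 (stair N z') *m pdiff_mx g D (stair N z') N
      = x *m pdiff_mx g D (stair N z') N.
    by rewrite /pdiff_mx !mulmxA -[x *m _ *m _]mulmxA restrMid.
  by rewrite -restr_stairN -(restr_stairN_mono N h) !mulmxA -/(pdiff g D (stair N z) x) xc.2 mul0mx.
- move=> z w q x e hx h; apply/(RX0 _ _ _ hx); apply: pcycle_orth hx.1 _.
  by move=> y yP /(cocycle_dual_represents e yP)[q' hq']; exact: h hq'.
- move=> z w q y e hy h; apply/(dual_represents0 e hy).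
  apply: cocycle_orth (dual_represents_cocycle e hy).1 _ => x xc.
  have [q' hq'] := pcycle_represents (descent_pcycle DD Dg (leqnn N) xc).
  apply: (h q'); split=> //; exists (x *m descent g D z N) => //.
  by rewrite subrr; exact: sub0mx.
Qed.

End Ladder.

(** * Minimality in coordinates *)

Section Splitting.
Context (F : fieldType) (N : nat).
Implicit Types L M : pmod F N.

Lemma gle_anti (z w : grade N) : gle z w -> gle w z -> z = w.
Proof.
move=> /gleP zw /gleP wz; apply/ffunP => i; apply/eqP.
by rewrite eq_le zw wz.
Qed.

Section Kernel.
Context (L M : pmod F N) (h : phom L M).

Lemma hker_map_linear z w (zw : gle z w) :
  linear (hker_map zw : hker h z -> hker h w).
Proof. by move=> a x y; apply: val_inj; rewrite /= !linearP. Qed.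
HB.instance Definition _ z w zw :=
  GRing.isLinear.Build F _ _ _ (hker_map zw : hker h z -> hker h w)
    (@hker_map_linear z w zw).

Definition pker : pmod F N.
Proof.
refine (@PMod F N (fun z => hker h z) (fun z w zw => hker_map zw) _ _).
- abstract by move=> z zz x; apply: val_inj; exact: pmap_id.
- abstract by move=> z w v h1 h2 h3 x; apply: val_inj; exact: pmap_comp.
Defined.

Lemma hker0 z (x : hker h z) : h z (val x) = 0.
Proof. by case: x => x /=; rewrite inE => /eqP. Qed.

End Kernel.

Lemma pker_map L L' M M' (h : phom L M) (h' : phom L' M') (f : phom L L')
    (f' : phom M M') : pcomp h' f = pcomp f' h ->
  exists k : phom (pker h) (pker h'), forall z x, val (k z x : hker h' z) = f z (val (x : hker h z)).
Proof.
move=> e; have hf z x : h' z (f z x) = f' z (h z x) := congr1 (fun u : phom _ _ => u z x) e.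
have [||||k kR] := @rel_phom _ _ (pker h) (pker h') (fun z x y => val y = f z (val x)).
- by move=> z a x x' y y' /= e1 e2; rewrite linearP -e1 -e2.
- by move=> z w zw x y /= e1; rewrite happ_nat -e1.
- move=> z x; have xP : f z (val x) \in kernel_pred (h' z).
    by rewrite inE hf hker0 linear0.
  by exists (Kernel xP).
- by move=> z y /= e1; apply: val_inj; rewrite /= e1 linear0.
- by exists k => z x; apply/kR.
Qed.


(** A retract of a complex splits off, with the kernel of the retraction as complement. *)
Lemma retract_ciso (B C : complex F N) (i : forall m, phom (B m) (C m))
    (r : forall m, phom (C m) (B m)) :
  (forall p q, pcomp (i q) (cdiff B p q) = pcomp (cdiff C p q) (i p)) ->
  (forall p q, pcomp (r q) (cdiff C p q) = pcomp (cdiff B p q) (r p)) ->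
  (forall m, pcomp (r m) (i m) = pid (B m)) ->
  exists C', ciso C (csum B C').
Proof.
move=> ci cr ri.
have ciE p q z x : i q z (cdiff B p q z x) = cdiff C p q z (i p z x) :=
  congr1 (fun u : phom _ _ => u z x) (ci p q).
have riE m z x : r m z (i m z x) = x := congr1 (fun u : phom _ _ => u z x) (ri m).
pose d p q := projT1 (cid (pker_map (cr p q))).
have dE p q z x : val (d p q z x : hker (r q) z) = cdiff C p q z (val (x : hker (r p) z)).
  by rewrite /d; case: cid.
have d_shape p q : p <> q + 1 -> d p q = 0.
  by move=> pq; apply: phomP => z x; apply: val_inj; rewrite dE cdiff_shape.
have d_comp p q s : pcomp (d q s) (d p q) = 0.
  apply: phomP => z x; apply: val_inj; rewrite pcompE !dE.
  exact: (congr1 (fun u : phom _ _ => u z (val x)) (cdiff_comp C p q s)).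
pose C' := Complex d_shape d_comp.
pose R m z (x : C m z) (y : psum (B m) (C' m) z) := x = i m z y.1 + val (y.2 : hker (r m) z).
have rR m z x y : R m z x y -> r m z x = y.1.
  by move=> ->; rewrite linearD riE hker0 addr0.
have iso m : exists (f : phom (C m) (psum (B m) (C' m))) g,
    [/\ pcomp g f = pid _, pcomp f g = pid _ & forall z x y, R m z x y <-> f z x = y].
  apply: rel_piso.
  - move=> z a x x' y y' -> ->; rewrite /R /= !linearP /=.
    by rewrite scalerDr addrACA.
  - by move=> z w zw x y ->; rewrite /R /= linearD happ_nat.
  - move=> z x; have xP : x - i m z (r m z x) \in kernel_pred (r m z).
      by rewrite inE linearB riE subrr.
    by exists (r m z x, Kernel xP); rewrite /R /= addrC subrK.
  - by move=> z y; exists (i m z y.1 + val (y.2 : hker (r m) z)).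
  - move=> z [b c] h; have /= := rR _ _ _ _ h; rewrite linear0 => b0.
    move: h; rewrite /R -b0 /= linear0 add0r => c0.
    by congr pair; apply: val_inj.
  - by move=> z x; rewrite /R /= linear0 add0r.
pose f m := projT1 (cid (iso m)).
have fP m : exists g, [/\ pcomp g (f m) = pid _, pcomp (f m) g = pid _
    & forall z x y, R m z x y <-> f m z x = y] by rewrite /f; case: cid.
pose g m := projT1 (cid (fP m)).
have gP m : [/\ pcomp (g m) (f m) = pid _, pcomp (f m) (g m) = pid _
    & forall z x y, R m z x y <-> f m z x = y] by rewrite /g; case: cid.
exists C', f, g; split=> [p q|m|m]; try by case: (gP m).
have [_ _ fp] := gP p; have [_ _ fq] := gP q.
apply: phomP => z x; rewrite pcompE; apply/fq.
have : R p z x (f p z x) by apply/fp.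
by rewrite /R /= /psum_hom_at /= => {1}->; rewrite linearD ciE dE.
Qed.

Lemma happD L M (f g : phom L M) z x : (f + g) z x = f z x + g z x.
Proof. by []. Qed.

(** The components of a ball are F(z) or 0 depending on a boolean; these three lemmas compute
    with the canonical maps between such components without rewriting inside types. *)
Lemma pif_id_right (b c : bool) M z (x : pif b M z) :
  c -> pif_id c true M z (pif_id b c M z x) = pif_id b true M z x.
Proof. by case: b x; case: c. Qed.

Lemma pif_id_left (b c : bool) M z (x : M z) :
  b -> pif_id b c M z (pif_id true b M z x) = pif_id true c M z x.
Proof. by case: b; case: c. Qed.

Lemma pif_id_retract (b : bool) M (f : phom M M) z (x : pif b M z) :
  (b -> forall y : M z, f z y = y) -> pif_id true b M z (f z (pif_id b true M z x)) = x.
Proof.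
by case: b x => /= [x ->|x _] //; rewrite [x]thinmx0 [LHS]thinmx0.
Qed.

(** A component of the differential that is invertible from a summand F(z) to a summand F(z)
    splits off a ball: [iota] and its image under the differential map the ball into C, and
    [pi], preceded by the differential in the upper degree, maps C back to the ball. *)
Lemma split_ball (C : complex F N) (z : grade N) (k : int)
    (iota : phom (pF F z) (C (k + 1))) (pi : phom (C k) (pF F z)) :
  pcomp pi (pcomp (cdiff C (k + 1) k) iota) = pid (pF F z) ->
  exists C', ciso C (csum (ball F z k) C').
Proof.
move=> pdi.
have pdiE w x : pi w (cdiff C (k + 1) k w (iota w x)) = x :=
  congr1 (fun u : phom _ _ => u w x) pdi.
have ddE p q s w x : cdiff C q s w (cdiff C p q w x) = 0 :=
  congr1 (fun u : phom _ _ => u w x) (cdiff_comp C p q s).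
have shE p q w x : p <> q + 1 -> cdiff C p q w x = 0 by move/cdiff_shape ->.
(* The morphisms u and v between F(z) and all C m are defined at once, without transport
   along equalities of degrees; jid is the identity in equal degrees and 0 otherwise. *)
pose jid p q : phom (C p) (C q) := match p =P q with
  | ReflectT e => eq_rect p (fun t => phom (C p) (C t)) (pid (C p)) q e
  | ReflectF _ => 0
  end.
have jid1 p w x : jid p p w x = x.
  by rewrite /jid; case: eqP => // e; rewrite (eq_irrelevance e erefl).
have jid0 p q w x : p <> q -> jid p q w x = 0 by rewrite /jid; case: eqP.
have kk : k <> k + 1 by move/eqP; rewrite -subr_eq0 opprD addrA subrr sub0r oppr_eq0 oner_eq0.
have kk1 : k + 1 <> k by move=> e; apply: kk.
pose u m : phom (pF F z) (C m) := pcomp (jid (k + 1) m + cdiff C (k + 1) m) iota.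
pose v m : phom (C m) (pF F z) := pcomp pi (jid m k + cdiff C m k).
have u1 w x : u (k + 1) w x = iota w x.
  by rewrite /u pcompE happD jid1 shE ?addr0 // => /addIr.
have uk w x : u k w x = cdiff C (k + 1) k w (iota w x).
  by rewrite /u pcompE happD jid0 ?add0r.
have u0 m w x : m <> k + 1 -> m <> k -> u m w x = 0.
  move=> m1 mk; rewrite /u pcompE happD jid0; last by move=> e; apply: m1.
  by rewrite shE ?addr0 // => /addIr e; apply: mk.
have vk w x : v k w x = pi w x.
  by rewrite /v pcompE happD jid1 shE ?addr0.
have v1 w x : v (k + 1) w x = pi w (cdiff C (k + 1) k w x).
  by rewrite /v pcompE happD jid0 ?add0r.
have du p q w x : cdiff C p q w (u p w x) = if (p == k + 1) && (q == k) then u q w x else 0.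
  case: (eqVneq p (k + 1)) => [->|/eqP p1]; rewrite ?andTb ?andFb.
    rewrite u1; case: (eqVneq q k) => [->|/eqP qk]; first by rewrite uk.
    by apply: shE => /addIr e; apply: qk.
  case: (eqVneq p k) => [->|/eqP pk]; first by rewrite uk ddE.
  by rewrite u0 // linear0.
have vd p q w x : v q w (cdiff C p q w x) = if (p == k + 1) && (q == k) then v p w x else 0.
  case: (eqVneq q k) => [->|/eqP qk]; last first.
    by rewrite andbF /v pcompE happD ddE jid0 // addr0 linear0.
  rewrite andbT vk; case: (eqVneq p (k + 1)) => [e|/eqP p1]; first by subst p; rewrite v1.
  by rewrite shE // linear0.
have vu m w x : in_ball k m -> v m w (u m w x) = x.
  by move=> /orP[]/eqP ->; rewrite ?v1 ?vk ?u1 ?uk pdiE.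
clearbody u v.
apply: (@retract_ciso (ball F z k) C (fun m => pcomp (u m) (pif_id (in_ball k m) true (pF F z)))
    (fun m => pcomp (pif_id true (in_ball k m) (pF F z)) (v m))).
- move=> p q; apply: phomP => w x; rewrite !pcompE du /=.
  case: ifP => [/andP[_ /eqP qk]|_]; last by rewrite !linear0.
  by rewrite pif_id_right // qk /in_ball eqxx orbT.
- move=> p q; apply: phomP => w x; rewrite !pcompE vd /=.
  case: ifP => [/andP[/eqP pk _]|_]; last by rewrite linear0.
  by rewrite pif_id_left // pk /in_ball eqxx.
- move=> m; apply: phomP => w x; rewrite !pcompE -[v m w _]/(pcomp (v m) (u m) w _).
  by apply: pif_id_retract => mb y; exact: vu.
Qed.

Lemma psum_inl L M : exists f : phom L (psum L M), forall z x, f z x = (x, 0).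
Proof.
have [||||f fR] := @rel_phom _ _ L (psum L M) (fun z x y => y = (x, 0)).
- by move=> z a x x' y y' -> ->; congr pair; rewrite /= scaler0 addr0.
- by move=> z w zw x y ->; congr pair; rewrite /= linear0.
- by move=> z x; exists (x, 0).
- by move=> z y ->.
- by exists f => z x; apply/fR.
Qed.

Lemma psum_fst L M : exists f : phom (psum L M) L, forall z x, f z x = x.1.
Proof.
have [||||f fR] := @rel_phom _ _ (psum L M) L (fun z x y => y = x.1).
- by move=> z a x x' y y' -> ->.
- by move=> z w zw x y ->.
- by move=> z x; exists x.1.
- by move=> z y ->.
- by exists f => z x; apply/fR.
Qed.

(** Converse of [split_ball]. *)
Lemma ball_summand (C C' : complex F N) (z : grade N) (k : int) :
  ciso C (csum (ball F z k) C') ->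
  exists (iota : phom (pF F z) (C (k + 1))) (pi : phom (C k) (pF F z)),
    pcomp pi (pcomp (cdiff C (k + 1) k) iota) = pid (pF F z).
Proof.
move=> [f [g [fc gf fg]]].
have [inl inlE] := psum_inl (ball F z k (k + 1)) (C' (k + 1)).
have [fst fstE] := psum_fst (ball F z k k) (C' k).
exists (pcomp (g (k + 1)) (pcomp inl (pif_id true (in_ball k (k + 1)) (pF F z)))).
exists (pcomp (pif_id (in_ball k k) true (pF F z)) (pcomp fst (f k))).
apply: phomP => w x; rewrite !pcompE inlE.
set y := (_, _).
have fcE : f k w (cdiff C (k + 1) k w (g (k + 1) w y)) = cdiff (csum (ball F z k) C') (k + 1) k w y.
  rewrite -[LHS]/(pcomp (f k) (cdiff C (k + 1) k) w (g (k + 1) w y)) fc pcompE.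
  by rewrite -[f _ _ _]/(pcomp (f (k + 1)) (g (k + 1)) w y) fg.
rewrite fcE fstE /= !eqxx /=.
have b1 : in_ball k (k + 1) by rewrite /in_ball eqxx.
have b0 : in_ball k k by rewrite /in_ball eqxx orbT.
by rewrite pif_id_right // pif_id_left.
Qed.

Section Minimal.
Context (C : complex F N) (rk : int -> nat) (dg : forall i, 'I_(rk i) -> grade N).
Context (fr : forall i, frame (C i) (dg (i := i))).

(** The usual matrix criterion: a complex of free modules is minimal iff its differentials have
    entries in the maximal ideal, i.e. no nonzero entry between generators of equal grade. Unlike
    the definition by balls, it is visibly invariant under transposition. *)
Definition no_unit_entry := forall i j a b,
  phom_mx (fr i) (fr j) (cdiff C i j) a b != 0 -> dg a != dg b.

Lemma minimal_no_unit : minimal C -> no_unit_entry.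
Proof.
move=> mC i j a b Dab; apply/eqP => ab; apply: mC.
have ij : i = j + 1.
  by apply: contrapT => ij; move: Dab; rewrite cdiff_shape // phom_mx0 mxE eqxx.
subst i; set c := phom_mx _ _ _ a b in Dab.
have [|iota iotaE] := @phom_of_mx F N _ _ _ _ _ _ (frame_pF F (dg b)) (fr (j + 1)) (delta_mx 0 a).
  move=> o i; rewrite mxE -ab; have [->|] := eqVneq i a; first by rewrite gle_refl.
  by rewrite andbF eqxx.
have [|pi piE] := @phom_of_mx F N _ _ _ _ _ _ (fr j) (frame_pF F (dg b)) (c^-1 *: delta_mx b 0).
  move=> i o; rewrite !mxE; have [->|] := eqVneq i b; first by rewrite gle_refl.
  by rewrite mulr0 eqxx.
exists (dg b), j; apply: (@split_ball C _ _ iota pi).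
apply: (@phom_mx_inj _ _ _ _ _ _ _ _ (frame_pF F _) (frame_pF F _)).
rewrite (phom_mx_comp (frame_pF F _) (fr j)) (phom_mx_comp (frame_pF F _) (fr (j + 1))).
rewrite iotaE piE phom_mx_id -scalemxAr -rowE -colE.
apply/matrixP => x y; rewrite !ord1 [LHS]mxE [X in _ * X]mxE [X in _ * X]mxE -/c.
by rewrite mulVf // mxE.
Qed.

(** If [pi] and [iota] exhibit a ball, some product of entries of [iota], the differential and [pi]
    is nonzero, and it forces z <= b <= a <= z for the grades of the generators involved. *)
Lemma no_unit_minimal : no_unit_entry -> minimal C.
Proof.
move=> nu [z [k [C' /ball_summand[iota [pi]]]]].
move/(congr1 (phom_mx (frame_pF F z) (frame_pF F z))).
rewrite (phom_mx_comp _ (fr k)) (phom_mx_comp _ (fr (k + 1))) phom_mx_id => /matrixP/(_ 0 0).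
rewrite [RHS]mxE eqxx => h.
have : \sum_b \sum_a phom_mx (frame_pF F z) (fr (k + 1)) iota 0 a
    * phom_mx (fr (k + 1)) (fr k) (cdiff C (k + 1) k) a b
    * phom_mx (fr k) (frame_pF F z) pi b 0 != 0.
  apply: contraNneq (oner_neq0 F) => e; rewrite -[1]h -[X in _ == X]e mxE.
  by apply/eqP; apply: eq_bigr => b _; rewrite mxE big_distrl.
move/eqP; apply; apply: big1 => b _; apply: big1 => a _; apply/eqP.
apply/negPn/negP; rewrite !mulf_eq0 !negb_or => /andP[/andP[/phom_mx_neq0 az Dab] /phom_mx_neq0 zb].
have /eqP := nu _ _ _ _ Dab; apply; apply: gle_anti.
  exact: gle_trans az zb.
exact: phom_mx_neq0 Dab.
Qed.

End Minimal.
End Splitting.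

(** * Homology and exactness *)

Section Exactness.
Context (F : fieldType) (N : nat).
Implicit Types K L M X Y : pmod F N.

Lemma homology_zero_exact K L M (f : phom K L) (g : phom L M) :
  pcomp g f = 0 -> (is_zero (phomology f g) <-> exact_at f g).
Proof.
move=> gf; have gfE z x : g z (f z x) = 0 := congr1 (fun u : phom _ _ => u z x) gf.
split=> [h0 z x|ex z q].
  split=> [gx|[y <-]] //.
  have xP : x \in kernel_pred (g z) by rewrite inE gx.
  by apply/(hpi0 f (Kernel xP)); exact: h0.
rewrite -(hpi_repr q); apply/hpi0/ex; exact: hker0.
Qed.

Lemma is_zero_homology K L M (f : phom K L) (g : phom L M) :
  is_zero L -> is_zero (phomology f g).
Proof.
move=> L0 z q; rewrite -(hpi_repr q); apply/hpi0; exists 0.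
by rewrite linear0 [RHS]L0.
Qed.

(** When the outgoing differential vanishes, all of [L] consists of cycles and maps onto the
    homology. *)
Lemma homology_projection K L M (f : phom K L) (g : phom L M) : is_zero M ->
  exists p : phom L (phomology f g),
    (forall z q, exists x, p z x = q) /\ exact_at f p.
Proof.
move=> M0.
have [||||p pR] := @rel_phom _ _ L (phomology f g)
  (fun z x q => exists2 c : hker g z, val c = x & hpi f c = q).
- move=> z a x x' y y' [c <- <-] [c' <- <-]; exists (a *: c + c'); last exact: hpi_linear.
  by [].
- by move=> z w zw x y [c <- <-]; exists (hker_map zw c); rewrite //= hmapE.
- move=> z x; have xP : x \in kernel_pred (g z) by rewrite inE [g z x]M0.
  by exists (hpi f (Kernel xP)), (Kernel xP).
- by move=> z q [c c0 <-]; apply/hpi0; exists 0; rewrite linear0 c0.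
exists p; split=> [z q|z x].
  by exists (val (repr q)); apply/pR; exists (repr q); rewrite ?hpi_repr.
split=> [px|[y <-]]; last first.
  have yP : f z y \in kernel_pred (g z) by rewrite inE [g z _]M0.
  by apply/pR; exists (Kernel yP) => //; apply/hpi0; exists y.
by have /pR[c <- /hpi0] := px.
Qed.

Lemma homology_cokernel_piso K L M X (f : phom K L) (g : phom L M) (eps : phom L X) :
  is_zero M -> (forall z x, exists y, eps z y = x) -> exact_at f eps ->
  piso (phomology f g) X.
Proof.
move=> M0 eps_surj ex.
have [||||||i [j [ji ij _]]] := @rel_piso _ _ (phomology f g) X
  (fun z q x => exists2 c : hker g z, hpi f c = q & eps z (val c) = x); last by exists i, j.
- move=> z a x x' y y' [c <- <-] [c' <- <-]; exists (a *: c + c'); first exact: hpi_linear.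
  by rewrite -linearP.
- by move=> z w zw x y [c <- <-]; exists (hker_map zw c); rewrite /= ?hmapE ?happ_nat.
- by move=> z q; exists (eps z (val (repr q))), (repr q); rewrite ?hpi_repr.
- move=> z x; have [y <-] := eps_surj z x.
  have yP : y \in kernel_pred (g z) by rewrite inE [g z _]M0.
  by exists (hpi f (Kernel yP)), (Kernel yP).
- by move=> z x [c /hpi0/ex-> <-].
- by move=> z q [c <- /ex/hpi0].
Qed.

Lemma eventually_vanishes_zero X : is_zero X -> eventually_vanishes X.
Proof. by move=> X0; exists 0 => z [x]; rewrite [x]X0 eqxx. Qed.

Lemma eventually_vanishes_piso X Y :
  piso X Y -> eventually_vanishes Y -> eventually_vanishes X.
Proof.
move=> [f [g [gf _]]] [u hu]; exists u => z [x x0]; apply: hu; exists (f z x).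
apply: contraNneq x0 => fx; have /= <- := congr1 (fun h : phom _ _ => h z x) gf.
by rewrite fx linear0.
Qed.

Lemma dual_pair_along_piso X X' Y : piso X X' -> dual_pair X Y -> dual_pair X' Y.
Proof.
move=> [f [g [gf fg]]] [b [bl br bn bX bY]].
have gfE z x : g z (f z x) = x := congr1 (fun h : phom _ _ => h z x) gf.
have fgE z x : f z (g z x) = x := congr1 (fun h : phom _ _ => h z x) fg.
exists (fun z w e x y => b z w e (g z x) y); split.
- by move=> z w e a x x' y; rewrite linearP bl.
- by move=> z w e a x y y'; rewrite br.
- by move=> z w z' w' e e' h h' x y; rewrite happ_nat; exact: bn.
- by move=> z w e x /bX gx; rewrite -(fgE z x) gx linear0.
- by move=> z w e y hy; apply: (bY _ _ e) => x; rewrite -(gfE z x).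
Qed.

(** The homology [phomology f g] is supported above the grades of the generators of [L], so that
    its dual is supported below their opposites. *)
Lemma eventually_vanishes_dual K L M (f : phom K L) (g : phom L M) Y n
    (d : 'I_n -> grade N) :
  frame L d -> dual_pair (phomology f g) Y -> eventually_vanishes Y.
Proof.
move=> fr [b [bl br _ _ bY]].
exists [ffun j => \sum_i `|d i j|] => w [y y0].
have e : - w + w = 0 by rewrite addNr.
have [i iw] : exists i, gle (d i) (- w).
  apply: contrapT => none; move/eqP: y0; apply; apply: (bY _ _ e) => x.
  have -> : x = 0.
    rewrite -(hpi_repr x); apply/hpi0; exists 0; rewrite linear0.
    apply: (@fco_inj _ _ _ _ _ fr); rewrite linear0; apply/rowP => i.
    by rewrite mxE fco0 //; apply/negP => iw; apply: none; exists i.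
  have := bl _ _ e 1 0 0 y; rewrite scaler0 addr0 mul1r => h.
  by apply: (addrI (b _ _ e 0 y)); rewrite -h addr0.
apply/gleP => j; have /gleP/(_ j) := iw; rewrite !ffunE lerNr => h.
apply: (le_trans h); apply: (le_trans (ler_norm _)).
by rewrite normrN (bigD1 i) //= lerDl; apply: sumr_ge0.
Qed.

Lemma gdual_zero X : is_zero X -> is_zero (gdual X).
Proof. by move=> X0 z f; apply: phomP => w x; rewrite [x]X0 !linear0. Qed.

Lemma gdual_free X : finite_rank_free X -> finite_rank_free (gdual X).
Proof.
by move=> /finite_rank_free_frame[n [d [fr _]]]; exact: frame_finite_rank_free (gdual_frame fr).
Qed.

(** * Complexes of free modules *)

Lemma complex_frames (C : complex F N) : (forall i, finite_rank_free (C i)) ->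
  exists (rk : int -> nat) (dg : forall i, 'I_(rk i) -> grade N)
         (fr : forall i, frame (C i) (dg i)), True.
Proof.
move=> Cf; have fE i := finite_rank_free_frame (Cf i).
pose rk i := projT1 (cid (fE i)); pose dgE i := projT2 (cid (fE i)).
pose dg i : 'I_(rk i) -> grade N := projT1 (cid (dgE i)).
exists rk, dg, (fun i => projT1 (cid (projT2 (cid (dgE i))))).
by [].
Qed.

Lemma homologyE (C : complex F N) a b c d : a = d + 1 -> b = d -> c = d - 1 ->
  phomology (cdiff C a b) (cdiff C b c) = homology C d.
Proof. by move=> -> -> ->. Qed.

(** The duality for complexes indexed by integers, with the degrees of the dual complex up to
    propositional equality. *)
Lemma complex_duality (C : complex F N) (e : int) :
  (forall i, finite_rank_free (C i)) ->
  (forall k, (k <= N)%N -> eventually_vanishes (homology C (e + k%:Z))) ->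
  forall a b c, a = e + N%:Z - 1 -> b = e + N%:Z -> c = e + N%:Z + 1 ->
  dual_pair (homology C e) (phomology (gdual_map (cdiff C b a)) (gdual_map (cdiff C c b))).
Proof.
move=> /complex_frames[rk [dg [fr _]]] ev a b c ae be ce.
pose K (m : nat) : int := e - 1 + m%:Z.
have KS m : K m.+1 = e + m%:Z by rewrite /K -addn1 PoszD addrACA addNr addr0.
have KSS m : K m.+2 = e + m%:Z + 1 by rewrite KS -addn1 PoszD addrA.
have hE m : phomology (cdiff C (K m.+2) (K m.+1)) (cdiff C (K m.+1) (K m)) = homology C (e + m%:Z).
  by apply: homologyE; [exact: KSS | exact: KS | rewrite /K addrAC].
have {ae} -> : a = K N by rewrite ae /K addrAC.
have {be} -> : b = K N.+1 by rewrite be KS.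
have {ce} -> : c = K N.+2 by rewrite ce KSS.
have <- : phomology (cdiff C (K 2) (K 1)) (cdiff C (K 1) (K 0)) = homology C e.
  by rewrite hE addr0.
apply: (@homology_duality F N (fun m => C (K m)) (fun m => cdiff C (K m.+1) (K m)) _ 
  (fun m => rk (K m)) (fun m => dg (K m)) (fun m => fr (K m))).
  by move=> m; exact: cdiff_comp.
by move=> m mN; rewrite hE; exact: ev.
Qed.

Lemma minimal_resolution_length (G : complex F N) X : minimal_free_resolution G X ->
  forall d, N%:Z < d -> is_zero (G d).
Proof.
move=> [/complex_frames[rk [dg [fr _]]] [eps [_ _ _ ex]] mG].
have nu := minimal_no_unit (fr := fr) mG.
have exE a b c : 0 < b -> a = b + 1 -> c = b - 1 -> exact_at (cdiff G a b) (cdiff G b c).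
  by move=> b0 -> ->; exact: ex.
case=> // -[//|d] Nd z x.
have rk0 : rk d.+1 = 0%N.
  apply: (@minimal_length F N (fun m => rk m%:Z) (fun m => dg m%:Z)
    (fun m => phom_mx (fr m.+1) (fr m) (cdiff G m.+1 m))) => [i|i a b|i v|i a b|].
  - by rewrite -phom_mx_comp cdiff_comp phom_mx0.
  - exact: phom_mx_neq0.
  - apply: (@acyclic_ext _ _ _ _ _ (stair 0 v)) => [a|a|a|]; rewrite ?stair0 ?face0 //.
    have h0 : is_zero (phomology (cdiff G i.+2 i.+1) (cdiff G i.+1 i)).
      apply/homology_zero_exact; first exact: cdiff_comp.
      by apply: exE => //; rewrite -addn1 PoszD ?addrK.
    by apply: (@acyclic_homology F N (fun m => G m%:Z) (fun m => cdiff G m.+1 m)) => q; exact: h0.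
  - exact: nu.
  - by rewrite -ltnS.
apply: (@fco_inj _ _ _ _ _ (fr d.+1%:Z)); apply/rowP => i.
by exfalso; move: i; rewrite rk0 => -[].
Qed.

End Exactness.

Theorem corollary1p5 (F : fieldType) (N : nat) (d : int) (C : complex F N)
  (C_free : forall i : int, finite_rank_free (C i))
  (H_vanish : forall k : nat, (k <= N)%N ->
     eventually_vanishes (homology C (d + k%:Z)))
  (G : complex F N)
  (G_res : minimal_free_resolution G (cohomology (cgdual C) (d + N%:Z))) :
  minimal_free_resolution (chain_of_cochain (cgdual (cshift G N%:Z)))
    (homology C d).
Proof.
have CE : dual_pair (homology C d) (cohomology (cgdual C) (d + N%:Z)).
  exact: (complex_duality C_free H_vanish erefl erefl erefl).
have ev_E : eventually_vanishes (cohomology (cgdual C) (d + N%:Z)).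
  have [rk [dg [fr _]]] := complex_frames C_free.
  exact: eventually_vanishes_dual (fr d) CE.
have G_long := minimal_resolution_length G_res.
have [G_free [eps [G_neg eps_surj G_ex0 G_ex]] G_min] := G_res.
have [rk [dg [fr _]]] := complex_frames G_free.
have G_unit := minimal_no_unit (fr := fr) G_min.
have HG0 : piso (homology G 0) (cohomology (cgdual C) (d + N%:Z)).
  apply: homology_cokernel_piso eps_surj G_ex0; exact: G_neg.
have HGd e : e != 0 -> is_zero (homology G e).
  rewrite neq_lt => /orP[e0|e0]; first exact/is_zero_homology/G_neg.
  by apply/homology_zero_exact; [exact: cdiff_comp | exact: G_ex].
have ev_G e : eventually_vanishes (homology G e).
  have [->|/HGd] := eqVneq e 0; first exact: eventually_vanishes_piso HG0 ev_E.
  exact: eventually_vanishes_zero.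
set D := chain_of_cochain _.
have GD e i j k : i = e + 1 -> j = e -> k = e - 1 ->
    dual_pair (homology G (- e)) (phomology (cdiff D i j) (cdiff D j k)).
  move=> -> -> ->.
  apply: (complex_duality G_free (fun k _ => ev_G _)).
  - by rewrite opprD addrAC.
  - by [].
  - by rewrite opprB -addrA addrC.
have D_zero e : e < 0 -> is_zero (D e).
  by move=> e0; apply/gdual_zero/G_long; rewrite ltrDr oppr_gt0.
have D_free e : finite_rank_free (D e) by apply: gdual_free; exact: G_free.
split=> //.
- have HD : dual_pair (phomology (cdiff D 1 0) (cdiff D 0 (-1)))
      (cohomology (cgdual C) (d + N%:Z)).
    apply: dual_pair_sym; apply: dual_pair_along_piso HG0 _.
    by rewrite -oppr0; apply: GD.
  have [phi [psi [phiK psiK]]] := dual_pair_piso HD CE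
    (phomology_pfd _ _ (finite_rank_free_pfd (D_free 0)))
    (phomology_pfd _ _ (finite_rank_free_pfd (C_free d)))
    (phomology_pfd _ _ (finite_rank_free_pfd (gdual_free (C_free (d + N%:Z))))).
  have [p [p_surj p_ex]] :=
    homology_projection (cdiff D 1 0) (cdiff D 0 (-1)) (D_zero (-1) (ltrN10 _)).
  exists (pcomp phi p); split=> [| | |e e0].
  + exact: D_zero.
  + move=> z x; have [y hy] := p_surj z (psi z x); exists y.
    by rewrite pcompE hy; exact: (congr1 (fun h : phom _ _ => h z x) psiK).
  + move=> z x; rewrite -p_ex pcompE; split=> [h|->]; last by rewrite linear0.
    rewrite -[LHS](congr1 (fun h : phom _ _ => h z (p z x)) phiK : psi z (phi z (p z x)) = _).
    by rewrite h linear0.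
  + apply/homology_zero_exact; first exact: cdiff_comp.
    apply: dual_pair_zero (GD e _ _ _ erefl erefl erefl) (HGd _ _).
    by rewrite oppr_eq0 gt_eqF.
- apply: (@no_unit_minimal _ _ D _ _ (fun i => gdual_frame (fr (- i + N%:Z)))).
  move=> i j a b; rewrite [phom_mx _ _ _]gdual_map_mx mxE => /G_unit.
  by apply: contra => /eqP /addrI /oppr_inj ->.
Qed.
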